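(* Let $\Sigma$ be a topologically mixing topological Markov chain over a countable alphabet and let $\widehat\mu$ be an atomless mixing local weak $\sigma$-Gibbs measure for a potential $\phi:\Sigma\to\mathbb R$ with $\sum_{n\ge1}V_n(\phi)<\infty$, $P_G(\phi)<\infty$ and $\phi\in L^1(\widehat\mu)$. Let $\widehat P$ be an $N$-cylinder for some $N$ and $\{\ell_n\}\subset\mathbb N$. If the sequence $\{K_n\}$ of $\widehat\mu$ is unbounded, assume $\limsup_n\ell_n/n<\infty$, and if in addition the alphabet is infinite assume also $\sup\phi<\infty$. Let $w$ be a $\widehat\mu$-hitting point with $$\overline s:=\limsup_{n\to\infty}\frac1n\log\frac1{\widehat\mu(C(\ell_n,w))}<\infty .$$ Then $$\mathrm{Dim}_{\widehat\mu}(W_\sigma(\widehat P,\ell_n,w))\ge\frac{P_G(\phi)-\int\phi\,d\widehat\mu}{P_G(\phi)-\int\phi\,d\widehat\mu+\overline s}.$$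
   Context: Markov chain: $\mathcal I$ alphabet, $A=(a_{i,j})$ an $\mathcal I\times\mathcal I$ matrix with entries in $\{0,1\}$, $\Sigma=\{(i_0,i_1,\dots): i_k\in\mathcal I,\ a_{i_k,i_{k+1}}=1\ \forall k\}$, metric $d((i_k),(j_k))=2^{-m}$, $m=\min\{n: i_n\ne j_n\}$, left shift $\sigma$. An $n$-cylinder is a nonempty set $C_{i_0\dots i_n}=\{k\in\Sigma: k_r=i_r,\ 0\le r\le n\}$; $C(n,w):=C_{w_0\dots w_n}$. Topologically mixing: for all $a,b\in\mathcal I$ there is $N(a,b)$ such that for all $n\ge N(a,b)$ some $w\in\Sigma$ has $w_0=a$, $w_n=b$. $V_n(\phi)=\sup\{|\phi(w)-\phi(w')|: w_k=w'_k,\ 0\le k\le n-1\}$. Local weak Gibbs measure for $\phi$: a Borel probability $\widehat\mu$ for which there are a constant $P$, numbers $1\le K_n\le K_{n+1}$ with $\frac1n\log K_n\to0$ and constants $c(i)\ge1$ ($i\in\mathcal I$) such that for all $n\ge1$, all cylinders and $\widehat\mu$-a.e. $z\in C_{i_0\dots i_{n-1}}$, $\frac1{c(i_0)K_n}\le\widehat\mu(C_{i_0\dots i_{n-1}})/\exp(-nP+\sum_{j=0}^{n-1}\phi(\sigma^jz))\le c(i_0)K_n$. Local weak $\sigma$-Gibbs: in addition $\sigma$-invariant. Mixing: $\lim_n\widehat\mu(E\cap\sigma^{-n}F)=\widehat\mu(E)\widehat\mu(F)$ for Borel $E,F$. $w$ is a $\widehat\mu$-hitting point if there is an increasing sequence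 $\{p_j\}\subset\mathbb N$ with $\sup_jc(w_{p_j})<\infty$. Gurevich pressure: $P_G(\phi)=\lim_n\frac1n\log\sum_{w_0=i,\,\sigma^nw=w}\exp\sum_{j=0}^{n-1}\phi(\sigma^jw)$ (independent of $i$); it equals the constant $P$ above. $W_\sigma(\widehat P,\ell_n,w)=\{z\in\widehat P:\ \sigma^k(z)\in C(\ell_k,w)\text{ for infinitely many }k\}$. For $E\subset\Sigma$, $M_\alpha(E)=\lim_{\varepsilon\to0}\inf\{\sum_i\widehat\mu(F_i)^\alpha: E\subset\bigcup_iF_i,\ F_i\text{ cylinders},\ \mathrm{diam}\,F_i\le\varepsilon\}$, and $\mathrm{Dim}_{\widehat\mu}(E)=\inf\{\alpha\geq 0: M_\alpha(E)=0\}$. *)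

(* Defs.v *)
From HB Require Import structures.
From mathcomp Require Import all_boot all_order all_algebra.
From mathcomp Require Import all_classical all_reals all_analysis.

Set Implicit Arguments.
Unset Strict Implicit.
Unset Printing Implicit Defensive.

Import Order.TTheory GRing.Theory Num.Theory.
Import numFieldNormedType.Exports.

Local Open Scope classical_set_scope.
Local Open Scope ring_scope.

(* A countable alphabet [I] may be finite or infinite; the 0/1 transition matrix
   is a boolean relation.  Measurable types are pointed in the library, so
   non-emptiness of the sequence space is part of the structure (it is implied
   by the existence of a probability measure on that space). *)
Record transition (I : countType) := Transition {
  trans :> rel I;
  trans_ex : exists x : nat -> I, forall k, trans (x k) (x k.+1) }.

(* [R] is a phantom parameter: it is the field in which the metric takes its
   values. *)
Definition mshift (R : realType) (I : countType) (A : transition I) : Type :=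
  {x : nat -> I | forall k, A (x k) (x k.+1)}.

Section MarkovShift.
Context {R : realType} {I : countType} {A : transition I}.
Local Notation Sigma := (mshift R A).
Implicit Types (x y z : Sigma).

Definition coords x : nat -> I := proj1_sig x.

Lemma coords_inj : injective coords.
Proof. by move=> [x xP] [y yP] /= xy; apply: eq_exist. Qed.

HB.instance Definition _ := gen_eqMixin Sigma.
HB.instance Definition _ := gen_choiceMixin Sigma.

Definition mshift_point : Sigma :=
  let: exist x xP := cid (trans_ex A) in exist _ x xP.
HB.instance Definition _ := isPointed.Build Sigma mshift_point.

Definition sdist x y : R :=
  match pselect (exists n, coords x n != coords y n) with
  | left xy => 2 ^- ex_minn xy
  | right _ => 0
  end.

Lemma sdistP x y (n : nat) :
  reflect (forall k, (k <= n)%N -> coords x k = coords y k)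
          (sdist x y < 2 ^- n).
Proof.
rewrite /sdist; case: pselect => [xy|nxy]; last first.
  rewrite invr_gt0 exprn_gt0//; apply: ReflectT => k _.
  by apply/eqP/negPn/negP => ne; apply: nxy; exists k.
case: ex_minnP => m mne mmin.
rewrite ltf_pV2 ?posrE ?exprn_gt0// ltr_eXn2l ?ltr1n//.
apply: (iffP idP) => [nm k kn|eq_xy].
  apply/eqP/negPn/negP => /mmin; rewrite leqNgt => /negP; apply.
  exact: leq_ltn_trans kn nm.
rewrite ltnNge; apply/negP => mn.
by move: mne; rewrite eq_xy ?eqxx.
Qed.

Lemma sdist_xx x : sdist x x = 0.
Proof.
by rewrite /sdist; case: pselect => // xx; case: ex_minnP => n; rewrite eqxx.
Qed.

Lemma sdist_eq0 x y : sdist x y = 0 -> x = y.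
Proof.
move=> xy0; apply: coords_inj; apply/funext => n.
by apply: (elimT (sdistP x y n)) => //; rewrite xy0 invr_gt0 exprn_gt0.
Qed.

Lemma sdist_sym x y : sdist x y = sdist y x.
Proof.
rewrite /sdist; case: pselect => [xy|nxy]; case: pselect => [yx|nyx] //.
- congr (2 ^- _); case: ex_minnP => m hm m_min; case: ex_minnP => n hn n_min.
  by apply/eqP; rewrite eqn_leq m_min ?n_min // eq_sym.
- by case: nyx; case: xy => n; exists n; rewrite eq_sym.
- by case: nxy; case: yx => n; exists n; rewrite eq_sym.
Qed.

Lemma sdist_ge0 x y : 0 <= sdist x y.
Proof. by rewrite /sdist; case: pselect => // xy; rewrite invr_ge0 exprn_ge0. Qed.

Lemma sdist_triangle y x z : sdist x z <= sdist x y + sdist y z.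
Proof.
suff : sdist x z <= Num.max (sdist x y) (sdist y z).
  by move=> /le_trans; apply; rewrite ge_max lerDl lerDr !sdist_ge0.
rewrite leNgt; apply/negP; rewrite gt_max => /andP[].
rewrite {2 4}/sdist; case: pselect => [xz|_]; last first.
  by rewrite ltNge sdist_ge0.
case: ex_minnP => m mne _ /sdistP xy /sdistP yz.
by move: mne; rewrite xy// yz// eqxx.
Qed.

HB.instance Definition _ := isMetric.Build R Sigma
  sdist_xx sdist_eq0 sdist_sym sdist_triangle.

(* The Borel sigma-algebra of the metric topology. *)
HB.instance Definition _ :=
  Measurable.copy Sigma (g_sigma_algebraType (@open Sigma)).

Lemma sshift_subproof x k : A (coords x k.+1) (coords x k.+2).
Proof. exact: (proj2_sig x k.+1). Qed.

Definition sshift x : Sigma :=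
  exist _ (fun k => coords x k.+1) (sshift_subproof x).

(* [cyl n u] is C_{u_0 ... u_n}, possibly empty. *)
Definition cyl (n : nat) (u : nat -> I) : set Sigma :=
  [set x | forall r, (r <= n)%N -> coords x r = u r].

Definition is_cylinder (n : nat) (C : set Sigma) : Prop :=
  C !=set0 /\ exists u, C = cyl n u.

Definition diameter (E : set Sigma) : \bar R :=
  ereal_sup [set (mdist p.1 p.2)%:E | p in E `*` E].

Definition Vsup (phi : Sigma -> R) (n : nat) : \bar R :=
  ereal_sup [set (`|phi p.1 - phi p.2|)%:E | p in
    [set p : Sigma * Sigma |
      forall k, (k < n)%N -> coords p.1 k = coords p.2 k]].

Definition birkhoff (phi : Sigma -> R) (n : nat) (x : Sigma) : R :=
  \sum_(j < n) phi (iter j sshift x).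

(* The limit does not depend on the letter [i]. *)
Definition gurevich_pressure (phi : Sigma -> R) (i : I) : \bar R :=
  limn (fun n => (n%:R^-1)%:E *
    lne (\esum_(w in [set w : Sigma | coords w 0 = i /\ iter n sshift w = w])
           (expR (birkhoff phi n w))%:E))%E.

Section Measures.
Variable mu : probability Sigma R.

(* The bounds are required on every cylinder, so that every cylinder has
   positive measure: [gibbs_pos] keeps the almost-everywhere condition
   [gibbs_bound] from holding vacuously on null cylinders. *)
Record local_weak_gibbs (phi : Sigma -> R) (P : R) (K : nat -> R) (c : I -> R)
    : Prop := LocalWeakGibbs {
  gibbs_K : forall n, (0 < n)%N -> 1 <= K n /\ K n <= K n.+1;
  gibbs_K_subexp : (ln (K n) / n%:R) @[n --> \oo] --> 0;
  gibbs_c : forall i, 1 <= c i;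
  gibbs_pos : forall n C, is_cylinder n C -> (0 < mu C)%E;
  gibbs_bound : forall n u, (0 < n)%N -> cyl n.-1 u !=set0 ->
    {ae mu, forall z, cyl n.-1 u z ->
      (c (u 0%N) * K n)^-1 <=
        fine (mu (cyl n.-1 u)) / expR (- n%:R * P + birkhoff phi n z)
        <= c (u 0%N) * K n} }.

Definition invariant_measure : Prop :=
  forall E, measurable E -> mu (sshift @^-1` E) = mu E.

Definition local_weak_sigma_gibbs (phi : Sigma -> R) (P : R) (K : nat -> R)
    (c : I -> R) : Prop :=
  local_weak_gibbs phi P K c /\ invariant_measure.

Definition mixing_measure : Prop :=
  forall E F, measurable E -> measurable F ->
    mu (E `&` iter n sshift @^-1` F) @[n --> \oo] --> (mu E * mu F)%E.

Definition atomless : Prop :=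
  forall E, measurable E -> (0 < mu E)%E ->
    exists F, [/\ measurable F, F `<=` E & (0 < mu F < mu E)%E].

Definition Mmeas_eps (alpha : R) (E : set Sigma) (eps : R) : \bar R :=
  ereal_inf [set s | exists (D : set nat) (F : nat -> set Sigma),
    [/\ forall i, D i -> exists n, is_cylinder n (F i),
        forall i, D i -> (diameter (F i) <= eps%:E)%E,
        E `<=` \bigcup_(i in D) F i &
        s = (\esum_(i in D) (poweR (mu (F i)) alpha))%E]].

Definition Mmeas (alpha : R) (E : set Sigma) : \bar R :=
  lim (Mmeas_eps alpha E eps @[eps --> 0^'+]).

Definition Dim (E : set Sigma) : \bar R :=
  ereal_inf [set alpha%:E | alpha in [set a | 0 <= a /\ Mmeas a E = 0%E]].

End Measures.

Definition hitting_point (c : I -> R) (w : Sigma) : Prop :=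
  exists p : nat -> nat, {homo p : m n / (m < n)%N} /\
    has_ubound (range (fun j => c (coords w (p j)))).

Definition Wset (Phat : set Sigma) (l : nat -> nat) (w : Sigma) : set Sigma :=
  [set z | Phat z /\
    infinite_set [set k | cyl (l k) (coords w) (iter k sshift z)]].

End MarkovShift.

Definition topologically_mixing (R : realType) (I : countType)
    (A : transition I) : Prop :=
  forall a b : I, exists N : nat, forall n, (N <= n)%N ->
    exists w : mshift R A, coords w 0 = a /\ coords w n = b.

(* Main.v *)
Require Import Defs.
From HB Require Import structures.
From mathcomp Require Import all_boot all_order all_algebra.
From mathcomp Require Import all_classical all_reals all_analysis.
From mathcomp Require Import finmap measurable_realfun ring lra.

Set Implicit Arguments.
Unset Strict Implicit.
Unset Printing Implicit Defensive.

Import Order.TTheory GRing.Theory Num.Theory.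
Import numFieldNormedType.Exports.

Local Open Scope classical_set_scope.
Local Open Scope ring_scope.

(* Put h = P - int phi; comparing periodic sums with the measures of cylinders
   gives P_G = P.  Let a < h / (h + s) and let a countable family of cylinders C_i
   have small total content sum mu(C_i)^a.  We build nested cylinders F_0 = Phat,
   F_1, F_2, ... such that no C_i contains F_j and the C_i inside F_j have total
   content less than q mu(F_j)^a; their common point is covered by no C_i, and
   F_(j+1) is chosen so that the point visits the target at a time k_j.

   To pass from F to the next cylinder, take k large.  By mixing, a fixed
   proportion of the points z of F satisfy z_k = w_0, and by the mean ergodic
   theorem most of them lie in a cylinder G of length k with
   mu(G) <= exp(- k (h - e)).  Following w after time k leads to F' inside G with
   mu(F') >= mu(G) exp(- k (s + 4 e)), so that a (h + s) < h makes
   mu(F')^a / mu(G) as large as we wish.  If every such F' violated the invariant,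
   summing over the disjoint cylinders G would contradict the bound on the content
   of the C_i inside F. *)

(** * Elementary estimates on sequences *)

Lemma natr_ge_near (R : realType) (C e : R) : 0 < e -> \forall k \near \oo, C <= e * k%:R.
Proof.
move=> e0; exists (Num.truncn (C / e)).+1 => // k /= Ck.
rewrite mulrC -ler_pdivrMr//; apply: ltW.
by apply: lt_le_trans (truncnS_gt _) _; rewrite ler_nat.
Qed.

(** With truncated subtraction [maxn (i - j) (j - i)] is |i - j|, and each distance is attained by
    at most two indices j, one on either side of i. *)
Lemma sum_distn_le (R : realType) (rho : nat -> R) (n i : nat) :
  (forall k, 0 <= rho k) -> (i < n)%N ->
  \sum_(j < n) rho (maxn (i - j) (j - i)) <= 2 * \sum_(k < n) rho k.
Proof.
move=> rho0 ltin.
rewrite -(big_mkord xpredT (fun j => rho (maxn (i - j) (j - i)))).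
rewrite -(big_mkord xpredT rho) mulr_natl mulr2n.
have sub_le a : (a <= n)%N -> \sum_(0 <= k < a) rho k <= \sum_(0 <= k < n) rho k.
  by move=> an; rewrite [leRHS](big_cat_nat (n := a))//= lerDl sumr_ge0.
rewrite (big_cat_nat (n := i.+1))//=; apply: lerD.
  rewrite big_nat_rev/= add0n; apply: le_trans (sub_le i.+1 ltin).
  rewrite big_nat [leRHS]big_nat; apply: ler_sum => k /andP[_ ki].
  have ki' : (k <= i)%N by [].
  rewrite subSS subKn//.
  have -> : (i - k - i = 0)%N by apply/eqP; rewrite subn_eq0 leq_subr.
  by rewrite maxn0.
rewrite -{1}[i.+1]add0n big_addn.
apply: le_trans (sub_le (n - i)%N (leq_subr _ _)).
rewrite -(subnSK ltin) big_nat_recl//= -[leLHS]add0r lerD//.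
apply: ler_sum => k _.
have -> : (i - (k + i.+1) = 0)%N.
  by apply/eqP; rewrite subn_eq0 addnS -addSn leq_addl.
by rewrite max0n addnS -addSn addnK.
Qed.

(** * Mean ergodic theorem for mixing maps *)

Section MeanErgodic.
Context d (T : measurableType d) (R : realType) (mu : probability T R).
Variable S : T -> T.
Hypothesis mS : measurable_fun setT S.
Hypothesis inv : forall E, measurable E -> mu (S @^-1` E) = mu E.

Lemma measurable_iter j : measurable_fun setT (iter j S).
Proof.
elim: j => [|j IH]; first exact: measurable_id.
exact: (measurableT_comp mS IH).
Qed.

Lemma measurable_iter_preimage j E : measurable E -> measurable (iter j S @^-1` E).
Proof. by move=> mE; rewrite -[X in measurable X]setTI; exact: measurable_iter. Qed.

Lemma measure_iter j E : measurable E -> mu (iter j S @^-1` E) = mu E.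
Proof.
elim: j E => [//|j IH] E mE.
have mSE : measurable (S @^-1` E) by rewrite -[X in measurable X]setTI; exact: mS.
by rewrite -(inv mE) -(IH _ mSE).
Qed.

Lemma ge0_integral_iter j (f : T -> \bar R) : measurable_fun setT f ->
  (forall x, 0 <= f x)%E -> (\int[mu]_x f (iter j S x) = \int[mu]_x f x)%E.
Proof.
move=> mf f0.
rewrite -[LHS](@ge0_integral_pushforward _ _ _ _ _ _ (measurable_iter j) mu setT)//.
have mi := measurable_iter j.
by apply: (eq_measure_integral mu) => A mA _; exact: measure_iter.
Qed.

Lemma ae_iter j (Q : T -> Prop) :
  {ae mu, forall x, Q x} -> {ae mu, forall x, Q (iter j S x)}.
Proof.
move=> [A [mA A0 QA]]; exists (iter j S @^-1` A); split.
- exact: measurable_iter_preimage.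
- by rewrite measure_iter.
- by move=> x Qx; apply: QA.
Qed.

Definition deviation (f : T -> R) (m : R) (n : nat) : \bar R :=
  (\int[mu]_x (`|n%:R^-1 * (\sum_(j < n) f (iter j S x)) - m|)%:E)%E.

Definition mean_cvg (f : T -> R) (m : R) :=
  forall e : R, 0 < e -> \forall n \near \oo, (deviation f m n <= e%:E)%E.

Lemma measurable_average (f : T -> R) n (m : R) : measurable_fun setT f ->
  measurable_fun setT (fun x => n%:R^-1 * (\sum_(j < n) f (iter j S x)) - m).
Proof.
move=> mf; apply: measurable_funB => //; apply: measurable_funM => //.
apply: measurable_sum => j; exact: (measurableT_comp mf (measurable_iter j)).
Qed.

(** Invariance makes averaging an L1 contraction, so the averages of f and g are no further apart in
    L1 than f and g. The deviation of f is at most this distance, plus the deviation of g, plus |m -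
    m'|. *)
Lemma mean_cvg_approx (f : T -> R) (m : R) : measurable_fun setT f ->
  (forall e : R, 0 < e -> exists g m', [/\ measurable_fun setT g, mean_cvg g m',
     (\int[mu]_x (`|f x - g x|)%:E <= e%:E)%E & `|m - m'| <= e]) ->
  mean_cvg f m.
Proof.
move=> mf H e e0.
have e30 : 0 < e / 3 by rewrite divr_gt0.
have [g [m' [mg gm' fg mm']]] := H _ e30.
have := gm' _ e30; apply: filterS2 (nbhs_infty_gt 0) => n n0 dev.
pose D j x := (`|f (iter j S x) - g (iter j S x)|)%:E.
have D0 j x : (0 <= D j x)%E by rewrite lee_fin.
have mD j : measurable_fun setT (D j).
  apply/measurable_EFinP/measurableT_comp => //; apply: measurable_funB.
    exact: (measurableT_comp mf (measurable_iter j)).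
  exact: (measurableT_comp mg (measurable_iter j)).
have intD j : (\int[mu]_x D j x <= (e/3)%:E)%E.
  rewrite (@ge0_integral_iter j (fun x => (`|f x - g x|)%:E))//.
  by apply/measurable_EFinP/measurableT_comp => //; exact: measurable_funB.
have mS' : measurable_fun setT (fun x => (\sum_(j < n) D j x)%E).
  exact: emeasurable_sum.
apply: (@le_trans _ _ (\int[mu]_x ((n%:R^-1)%:E * (\sum_(j < n) D j x) +
   ((`|n%:R^-1 * (\sum_(j < n) g (iter j S x)) - m'|)%:E + (`|m - m'|)%:E)))%E).
  apply: ge0_le_integral => //.
  - by apply/measurable_EFinP/measurableT_comp => //; exact: measurable_average.
  - apply: emeasurable_funD; first exact: emeasurable_funM.
    apply: emeasurable_funD => //.
    by apply/measurable_EFinP/measurableT_comp => //; exact: measurable_average.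
  - move=> x _; rewrite sumEFin -!EFinM -!EFinD lee_fin.
    have -> : n%:R^-1 * (\sum_(j < n) f (iter j S x)) - m =
       n%:R^-1 * (\sum_(j < n) (f (iter j S x) - g (iter j S x))) +
       ((n%:R^-1 * (\sum_(j < n) g (iter j S x)) - m') - (m - m')).
      by rewrite sumrB mulrBr; ring.
    apply: le_trans (ler_normD _ _) _; apply: lerD; last exact: ler_normB.
    rewrite normrM ger0_norm ?invr_ge0// ler_pM2l ?invr_gt0 ?ltr0n//.
    exact: ler_norm_sum.
rewrite ge0_integralD//; last 4 first.
- by move=> x _; apply: mule_ge0; [rewrite lee_fin invr_ge0|exact: sume_ge0].
- exact: emeasurable_funM.
- by move=> x _; rewrite -EFinD lee_fin addr_ge0.
- apply: emeasurable_funD => //.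
  by apply/measurable_EFinP/measurableT_comp => //; exact: measurable_average.
rewrite ge0_integralZl//; last first.
- by move=> x _; exact: sume_ge0.
rewrite ge0_integral_sum// ge0_integralD//; last first.
  by apply/measurable_EFinP/measurableT_comp => //; exact: measurable_average.
have -> : e%:E = ((e/3)%:E + ((e/3)%:E + (e/3)%:E))%E.
  by rewrite -!EFinD; congr EFin; field.
apply: leeD; last first.
  apply: leeD; first exact: dev.
  rewrite integral_cst// [X in (_ * X)%E](_ : _ = 1%E) ?mule1 ?lee_fin//.
  exact: probability_setT.
apply: (@le_trans _ _ ((n%:R^-1)%:E * (\sum_(j < n) (e/3)%:E))%E).
  apply: lee_wpmul2l; first by rewrite lee_fin invr_ge0.
  by apply: lee_sum => j _.
rewrite sumEFin -EFinM lee_fin sumr_const card_ord -[X in _ * X]mulr_natl mulrA mulVf ?mul1r//.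
by rewrite pnatr_eq0 -lt0n.
Qed.

Hypothesis mix : forall E F, measurable E -> measurable F ->
  mu (E `&` iter n S @^-1` F) @[n --> \oo] --> (mu E * mu F)%E.

Lemma probability_integral_cst (r : R) : (\int[mu]_x (cst r%:E x) = r%:E)%E.
Proof.
rewrite integral_cst// [X in (_ * X)%E](_ : _ = 1%E) ?mule1//.
exact: probability_setT.
Qed.

Section Indicator.
Variable E : set T.
Hypothesis mE : measurable E.
Let m := fine (mu E).
Let X j x : R := \1_E (iter j S x) - m.
Let rho k := `|fine (mu (E `&` iter k S @^-1` E)) - m ^+ 2|.

Let muE : mu E = m%:E.
Proof. by rewrite fineK// fin_num_measure. Qed.

Let measurable_indicS j : measurable_fun setT (fun x => \1_E (iter j S x) : R).
Proof.
exact: (measurableT_comp (measurable_indic (R := R) mE) (measurable_iter j)).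
Qed.

Let integrable_le1 (f : T -> R) : measurable_fun setT f ->
  (forall x, `|f x| <= 1) -> mu.-integrable setT (EFin \o f).
Proof.
move=> mf f1; apply: measurable_bounded_integrable => //.
  exact: fin_num_fun_lty.
exists 1; split; [exact: num_real|move=> M M1 x _].
by apply: le_trans (f1 x) _; exact: ltW.
Qed.

Let integral_deviation_mul i j : (\int[mu]_x (X i x * X j x)%:E =
  (fine (mu (iter i S @^-1` E `&` iter j S @^-1` E)) - m ^+ 2)%:E)%E.
Proof.
have mSE k := measurable_iter_preimage k mE.
have mI := measurableI _ _ (mSE i) (mSE j).
have int1 F : measurable F -> mu.-integrable setT (EFin \o (\1_F : T -> R)).
  move=> mF; apply: integrable_le1; first exact: measurable_indic.
  by move=> x; rewrite indicE; case: (_ \in _); rewrite ?normr1 ?normr0.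
have fE : (fun x => (X i x * X j x)%:E) =
  (fun x => (\1_(iter i S @^-1` E `&` iter j S @^-1` E) x)%:E + ((- m)%:E *
   (\1_(iter i S @^-1` E) x)%:E + ((- m)%:E * (\1_(iter j S @^-1` E) x)%:E +
   (cst (m ^+ 2) x)%:E)))%E.
  apply/funext => x; rewrite /X -!EFinM -!EFinD; congr EFin.
  have -> k : \1_(iter k S @^-1` E) x = \1_E (iter k S x) :> R by [].
  by rewrite indicI/= /cst; ring.
have icst := finite_measure_integrable_cst mu (m ^+ 2) (@measurableT _ T).
have iZ F (mF : measurable F) := integrableZl measurableT (- m) (int1 F mF).
rewrite fE integralD//; [|exact: int1|]; last first.
  apply: integrableD => //; first exact: iZ.
  by apply: integrableD => //; exact: iZ.
rewrite integralD//; [|exact: iZ|]; last first.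
  by apply: integrableD => //; exact: iZ.
rewrite integralD//; last exact: iZ.
rewrite !integralZl//; [|exact: int1|exact: int1].
have intI F : measurable F -> (\int[mu]_x (\1_F x)%:E = mu F)%E.
  by move=> mF; rewrite integral_indic// setIT.
rewrite !intI// !measure_iter// muE.
rewrite probability_integral_cst -(@fineK _ (mu _)) ?fin_num_measure// -!EFinM -!EFinD.
by congr EFin; ring.
Qed.

Let rho_cvg0 : rho k @[k --> \oo] --> 0.
Proof.
have /fine_cvgP[_] : mu (E `&` iter n S @^-1` E) @[n --> \oo] --> (m * m)%:E.
  by rewrite EFinM -muE; exact: mix.
rewrite -expr2 => mm.
by rewrite -(normr0 R) -(subrr (m ^+ 2)); apply: cvg_norm; apply: cvgB => //; exact: cvg_cst.
Qed.

Let mean_rho_cvg0 : (n%:R^-1 * \sum_(k < n) rho k) @[n --> \oo] --> 0.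
Proof.
(* [arithmetic_mean] at index n averages n + 1 terms, hence the shift. *)
rewrite -(cvg_shiftS _); have := cesaro rho_cvg0.
apply: cvg_trans; apply: near_eq_cvg; near=> n.
by rewrite /arithmetic_mean/= /series/= big_mkord.
Unshelve. all: end_near. Qed.

(** Both sets are preimages under the smaller of the two powers of S; by invariance only the time
    difference matters. *)
Let correlation_shift i j :
  `|fine (mu (iter i S @^-1` E `&` iter j S @^-1` E)) - m ^+ 2| =
  rho (maxn (i - j) (j - i)).
Proof.
have aux a b : (a <= b)%N -> mu (iter a S @^-1` E `&` iter b S @^-1` E) =
   mu (E `&` iter (b - a) S @^-1` E).
  move=> ab; rewrite -(measure_iter a (measurableI _ _ mE
     (measurable_iter_preimage (b - a) mE))).
  congr (mu _); apply/seteqP; split => x /=; rewrite -iterD subnK//.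
have [ij|/ltnW ji] := leqP i j.
  by rewrite aux// (eqP (ij : (i - j == 0)%N)) max0n.
by rewrite setIC aux// (eqP (ji : (j - i == 0)%N)) maxn0.
Qed.

(* The mean square deviation is the double average over i, j < n of the
   correlations rho |i - j|, which tend to 0 by mixing. *)
Lemma mean_cvg_indic : mean_cvg (\1_E) m.
Proof.
move=> e e0.
have e20 : 0 < e / 2 by rewrite divr_gt0.
(* The bound (e/2)^2 / 2 absorbs the factor 2 of [sum_distn_le] and the division by e/2 below,
   leaving e/2. *)
have : \forall n \near \oo, n%:R^-1 * (\sum_(k < n) rho k) < (e / 2) ^+ 2 / 2.
  by apply: (cvgr_lt 0) => //; rewrite divr_gt0// exprn_gt0.
apply: filterS2 (nbhs_infty_gt 0) => n n0 rhon.
have n0' : n%:R != 0 :> R by rewrite pnatr_eq0 -lt0n.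
have mX j : measurable_fun setT (X j).
  by apply: measurable_funB => //; exact: measurable_indicS.
have XX x : n%:R^-1 * (\sum_(j < n) \1_E (iter j S x)) - m =
   n%:R^-1 * \sum_(j < n) X j x.
  rewrite sumrB mulrBr sumr_const card_ord -[m *+ n]mulr_natl mulrA mulVf//.
  by rewrite mul1r.
have m1 : 0 <= m <= 1.
  by rewrite fine_ge0//= -lee_fin -muE probability_le1.
have X1 j x : `|X j x| <= 1.
  rewrite /X indicE; case: (_ \in _) => /=; rewrite ler_norml; lra.
(* A pointwise quadratic bound takes the place of Cauchy-Schwarz: it controls the L1 deviation by
   the mean square, which expands into correlations. *)
apply: (@le_trans _ _ (\int[mu]_x ((e / 2)%:E + ((e / 2)^-1)%:E *
   ((n%:R^-1 ^+ 2)%:E * \sum_(i < n) \sum_(j < n) (X i x * X j x)%:E)))%E).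
  apply: ge0_le_integral => //.
  - apply/measurable_EFinP/measurableT_comp => //.
    by apply: measurable_average; exact: measurable_indic.
  - apply: emeasurable_funD => //; apply: emeasurable_funM => //.
    apply: emeasurable_funM => //; apply: emeasurable_sum => i.
    apply: emeasurable_sum => j; apply/measurable_EFinP.
    exact: measurable_funM.
  - move=> x _; rewrite XX.
    rewrite (eq_bigr (fun i : 'I_n => (\sum_(j < n) X i x * X j x)%:E)); last first.
      by move=> i _; rewrite sumEFin.
    rewrite sumEFin -!EFinM -!EFinD lee_fin.
    have -> : \sum_(i < n) \sum_(j < n) X i x * X j x = (\sum_(j < n) X j x) ^+ 2.
      by rewrite expr2 big_distrlr.
    rewrite -exprMn; set y := n%:R^-1 * _.
    (* |y| <= e / 2 + y ^ 2 / (e / 2) *)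
    have [ye|/ltW ye] := lerP `|y| (e / 2).
      rewrite -[leLHS]addr0 lerD//; apply: mulr_ge0; last exact: sqr_ge0.
      by rewrite invr_ge0 ltW.
    rewrite -[leLHS]add0r lerD//; first exact: ltW.
    rewrite -real_normK ?num_real// mulrC ler_pdivlMr// expr2.
    by rewrite ler_wpM2l.
have iXX i j : mu.-integrable setT (fun x => (X i x * X j x)%:E).
  apply: integrable_le1; first exact: measurable_funM.
  by move=> x; rewrite normrM mulr_ile1.
have iS i : mu.-integrable setT (fun x => \sum_(j < n) (X i x * X j x)%:E)%E.
  by apply: integrable_sum => // j _.
have iSS : mu.-integrable setT
   (fun x => \sum_(i < n) \sum_(j < n) (X i x * X j x)%:E)%E.
  by apply: integrable_sum => // j _.
have icst := finite_measure_integrable_cst mu (e / 2) (@measurableT _ T).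
rewrite integralD//; last by do 2 apply: integrableZl => //.
rewrite probability_integral_cst integralZl//; last exact: integrableZl.
rewrite integralZl// integral_sum//.
under eq_bigr do (rewrite integral_sum//; under eq_bigr do rewrite integral_deviation_mul).
under eq_bigr do rewrite sumEFin.
rewrite sumEFin -!EFinM -EFinD lee_fin.
rewrite [leRHS](splitr e) lerD// mulrC ler_pdivrMr// -expr2.
apply: (@le_trans _ _ (n%:R^-1 ^+ 2 * \sum_(i < n) (2 * \sum_(k < n) rho k))).
  rewrite ler_wpM2l//.
  apply: ler_sum => i _; apply: (@le_trans _ _ (\sum_(j < n) rho (maxn (i - j) (j - i)))).
    by apply: ler_sum => j _; rewrite -correlation_shift ler_norm.
  by apply: sum_distn_le => // k; exact: normr_ge0.
rewrite sumr_const card_ord -[X in _ * X]mulr_natl.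
move: rhon; set s := \sum_(k < n) _ => rhon.
have -> : n%:R^-1 ^+ 2 * (n%:R * (2 * s)) = 2 * (n%:R^-1 * s) by field.
lra.
Qed.

End Indicator.

Lemma mean_cvg0 : mean_cvg (cst 0) 0.
Proof.
move=> e e0; apply: nearW => n; rewrite /deviation.
under eq_integral do rewrite big1// mulr0 subrr normr0.
by rewrite integral0 lee_fin ltW.
Qed.

Lemma mean_cvg_linear (a : R) (f g : T -> R) (m p : R) :
  measurable_fun setT f -> measurable_fun setT g ->
  mean_cvg f m -> mean_cvg g p ->
  mean_cvg (fun x => a * f x + g x) (a * m + p).
Proof.
move=> mf mg fm gp e e0.
have a0 : 0 < `|a| + 1 by rewrite ltr_wpDl.
have e1 : 0 < e / 2 / (`|a| + 1) by rewrite !divr_gt0.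
have e2 : 0 < e / 2 by rewrite divr_gt0.
apply: filterS2 (fm _ e1) (gp _ e2) => n fmn gpn.
have mA (h : T -> R) q : measurable_fun setT h -> measurable_fun setT
    (fun x => (`|n%:R^-1 * (\sum_(j < n) h (iter j S x)) - q|)%:E).
  move=> mh; apply/measurable_EFinP/measurableT_comp => //.
  exact: measurable_average.
apply: (@le_trans _ _ (\int[mu]_x (`|a|%:E *
   (`|n%:R^-1 * (\sum_(j < n) f (iter j S x)) - m|)%:E +
   (`|n%:R^-1 * (\sum_(j < n) g (iter j S x)) - p|)%:E))%E).
  apply: ge0_le_integral => //.
  - apply: (mA (fun x => a * f x + g x)); apply: measurable_funD => //; exact: measurable_funM.
  - by apply: emeasurable_funD; [apply: emeasurable_funM => //|]; exact: mA.
  - move=> x _; rewrite -EFinM -EFinD lee_fin -normrM.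
    rewrite big_split/= -mulr_sumr.
    apply: (le_trans _ (ler_normD _ _)); rewrite le_eqVlt; apply/orP; left.
    by apply/eqP; congr (`|_|); ring.
rewrite ge0_integralD//; [|by apply: emeasurable_funM => //; exact: mA|exact: mA].
rewrite ge0_integralZl//; last exact: mA.
have -> : e%:E = (e/2 + e/2)%:E by rewrite -splitr.
rewrite EFinD; apply: leeD => //.
apply: (@le_trans _ _ (`|a|%:E * (e / 2 / (`|a| + 1))%:E)%E).
  by apply: lee_wpmul2l => //.
rewrite -EFinM lee_fin mulrCA ler_piMr ?ltW// ltr_pdivrMr ?mul1r//.
by rewrite ltrDl.
Qed.

Lemma mean_cvg_sum (I : Type) (s : seq I) (a : I -> R) (f : I -> T -> R)
    (m : I -> R) :
  (forall i, measurable_fun setT (f i)) -> (forall i, mean_cvg (f i) (m i)) ->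
  mean_cvg (fun x => \sum_(i <- s) a i * f i x) (\sum_(i <- s) a i * m i).
Proof.
move=> mf fm; elim: s => [|i s IH].
  rewrite big_nil (_ : (fun x => _) = cst 0); first exact: mean_cvg0.
  by apply/funext => x; rewrite big_nil.
rewrite big_cons.
have -> : (fun x => \sum_(i <- i :: s) a i * f i x) =
   (fun x => a i * f i x + \sum_(i <- s) a i * f i x).
  by apply/funext => x; rewrite big_cons.
apply: mean_cvg_linear => //.
by apply: measurable_sum => j; exact: measurable_funM.
Qed.

Import HBSimple.

Lemma mean_cvg_sfun (f : {sfun T >-> R}) :
  mean_cvg f (fine (\int[mu]_x (f x)%:E)%E).
Proof.
have mpre y : measurable (f @^-1` [set y]).
  exact: measurable_sfunP.
have fE x : f x = \sum_(y <- fset_set (range f)) y * \1_(f @^-1` [set y]) x.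
  by rewrite {1}fimfunE fsbig_finite.
have int1 y : mu.-integrable setT (EFin \o (\1_(f @^-1` [set y]) : T -> R)).
  exact: integrable_indic.
have -> : fine (\int[mu]_x (f x)%:E)%E =
    \sum_(y <- fset_set (range f)) y * fine (mu (f @^-1` [set y])).
  under eq_integral do rewrite fE -sumEFin.
  rewrite integral_sum//; last first.
    move=> y; under eq_fun do rewrite EFinM.
    apply: (integrableZl measurableT y (int1 y)).
  rewrite -[RHS]/(fine (_%:E)) -sumEFin; congr fine; apply: eq_bigr => y _.
  under eq_integral do rewrite EFinM.
  rewrite integralZl//; last exact: int1.
  by rewrite EFinM fineK ?fin_num_measure// integral_indic// setIT.
rewrite [X in mean_cvg X _](_ : _ =
    fun x => \sum_(y <- fset_set (range f)) y * \1_(f @^-1` [set y]) x); last first.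
  by apply/funext => x; exact: fE.
apply: (@mean_cvg_sum _ _ id (fun y => \1_(f @^-1` [set y]))
  (fun y => fine (mu (f @^-1` [set y])))) => y; first exact: measurable_indic.
exact: mean_cvg_indic.
Qed.

(** Simple functions are dense in L1, and the integrals of f and of its approximation differ by at
    most their L1 distance, so [mean_cvg_approx] applies. *)
Theorem mean_ergodic (f : T -> R) : mu.-integrable setT (EFin \o f) ->
  mean_cvg f (fine (\int[mu]_x (f x)%:E)%E).
Proof.
move=> intf; have mf : measurable_fun setT f.
  by apply/measurable_EFinP; exact: measurable_int intf.
apply: mean_cvg_approx => // e e0.
have [g [intg _ fg]] := approximation_sfun_integrable measurableT intf.
have : \forall n \near \oo,
    (\int[mu]_(z in setT) `|(f z)%:E - (g n z)%:E| < e%:E)%E.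
  by apply: (fg _ (open_ereal_lt' _)); rewrite lte_fin.
case=> n _ /(_ n (leqnn n)) fgn.
exists (g n), (fine (\int[mu]_x (g n x)%:E)%E); split.
- exact: measurable_funP.
- exact: mean_cvg_sfun.
- exact: ltW.
- rewrite -lee_fin -abse_EFin EFinB !fineK; last 2 first.
  + exact: integrable_fin_num (intg n).
  + exact: integrable_fin_num intf.
  rewrite -integralB//; last exact: intg.
  apply: le_trans (ltW fgn).
  apply: le_abse_integral => //; apply: emeasurable_funB.
    exact: measurable_int intf.
  exact: measurable_int (intg n).
Qed.

(** Markov's inequality: an L1 deviation of at most r e leaves measure at most r where the deviation
    is at least e. *)
Lemma weak_law (f : T -> R) (e : R) : mu.-integrable setT (EFin \o f) ->
  let m := fine (\int[mu]_x (f x)%:E)%E in 0 < e ->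
  forall r, 0 < r -> \forall n \near \oo,
  (mu [set x | e <= `|n%:R^-1 * (\sum_(j < n) f (iter j S x)) - m|]%R <= r%:E)%E.
Proof.
move=> intf m e0 r r0.
have mf : measurable_fun setT f.
  by apply/measurable_EFinP; exact: measurable_int intf.
have re : 0 < r * e by rewrite mulr_gt0.
apply: filterS (mean_ergodic intf re) => n dev.
have mA := measurable_average n m mf.
have := @le_integral_comp_abse _ _ _ mu setT measurableT
  (EFin \o (fun x => n%:R^-1 * (\sum_(j < n) f (iter j S x)) - m)) e id
  (@measurable_id _ _ _) (fun r r0 => r0).
rewrite setTI => H.
have {}H := H _ _ e0.
have := le_trans (H (fun x y _ _ xy => xy) _) dev.
rewrite mulrC EFinM lee_pmul2l//.
by apply; exact/measurable_EFinP.
Qed.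

End MeanErgodic.

(** * Cylinders and Gibbs bounds *)

Section Cylinders.
Context {R : realType} {I : countType} {A : transition I}.
Local Notation Sigma := (mshift R A).
Implicit Types (x y z : Sigma) (u : nat -> I).

Lemma coords_iter k x n : coords (iter k sshift x) n = coords x (n + k).
Proof. by elim: k n => [|k IH] n; rewrite ?addn0//= IH addSnnS. Qed.

Lemma cylxx n x : cyl n (coords x) x.
Proof. by []. Qed.

Lemma cylE n u x : cyl n u x -> cyl n u = cyl n (coords x) :> set Sigma.
Proof.
by move=> ux; apply/seteqP; split => y uy r rn; rewrite uy// ux.
Qed.

Lemma subset_cyl m n u : (m <= n)%N -> cyl n u `<=` (cyl m u : set Sigma).
Proof. by move=> mn x ux r rm; apply: ux; exact: leq_trans mn. Qed.

(** Admissibility concerns only consecutive letters, so two admissible sequences can be glued at a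
    common letter. *)
Lemma mshift_splice n x y : coords x n = coords y 0 ->
  exists z, (forall r, (r <= n)%N -> coords z r = coords x r) /\
            iter n sshift z = y.
Proof.
move=> xy.
pose c r := if (r <= n)%N then coords x r else coords y (r - n).
have cP k : A (c k) (c k.+1).
  rewrite /c; case: (ltngtP k n) => [kn|nk|->].
  - exact: (proj2_sig x k).
  - by rewrite subSn 1?ltnW//; exact: (proj2_sig y (k - n)%N).
  - by rewrite xy subSnn; exact: (proj2_sig y 0%N).
exists (exist _ c cP); split=> [r rn|]; first by rewrite /= /c rn.
apply: coords_inj; apply/funext => r; rewrite coords_iter /= /c addnK.
by case: leqP => //; rewrite -{2}[n]add0n leq_add2r leqn0 => /eqP ->; rewrite xy.
Qed.

Lemma ball_sdist x n : ball x (2 ^- n : R) = cyl n (coords x).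
Proof.
rewrite ballEmdist; apply/seteqP; split => y /=.
  by move=> /sdistP xy r rn; rewrite xy.
by move=> xy; apply/sdistP => r rn; rewrite xy.
Qed.

Lemma nbhs_cyl x (U : set Sigma) :
  nbhs x U <-> exists n, cyl n (coords x) `<=` U.
Proof.
split=> [/nbhs_ballP[e /= e0 eU]|[n nU]].
  have [n _ /(_ n (leqnn n))] : \forall n \near \oo, 2 ^- n < e :> R.
    have := @cvg_geometric R 1 (2^-1).
    rewrite ger0_norm ?invr_ge0// invf_lt1// ltr1n => /(_ isT).
    move=> /(cvgr_lt 0) /(_ _ e0); apply: filterS => k /=.
    by rewrite /geometric/= mul1r exprVn.
  move=> ne; exists n => y; rewrite -ball_sdist => yn; apply: eU.
  exact: le_ball (ltW ne) _ yn.
apply/nbhs_ballP; exists (2 ^- n) => /=; first by rewrite invr_gt0 exprn_gt0.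
by rewrite ball_sdist.
Qed.

Lemma open_cyl n u : open (cyl n u : set Sigma).
Proof.
rewrite openE => x ux; apply/nbhs_cyl.
by exists n; rewrite -(cylE ux).
Qed.

Lemma measurable_cyl n u : measurable (cyl n u : set Sigma).
Proof. by apply: sub_sigma_algebra; exact: open_cyl. Qed.

Lemma measurable_sshift : measurable_fun [set: Sigma] (@sshift R I A).
Proof.
apply: (@measurability _ _ _ _ _ _ (@open Sigma)) => //.
move=> _ [U oU <-]; rewrite setTI; apply: sub_sigma_algebra.
suff : open (sshift @^-1` U : set Sigma) by [].
rewrite openE => x Ux; apply/nbhs_cyl.
have /nbhs_cyl[n nU] : nbhs (sshift x) U by apply: open_nbhs_nbhs.
exists n.+1 => y xy; apply: nU => r rn; exact: xy.
Qed.

End Cylinders.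

Lemma ae_exists d (T : measurableType d) (R : realType)
    (mu : {measure set T -> \bar R}) (Q : T -> Prop) (E : set T) :
  {ae mu, forall x, Q x} -> measurable E -> (0 < mu E)%E ->
  exists2 x, E x & Q x.
Proof.
move=> [N [mN N0 QN]] mE E0; apply/not_exists2P => H.
have : (mu E <= mu N)%E.
  apply: le_measure; [exact: mem_set|exact: mem_set|move=> x Ex].
  by apply: QN => Qx; have [] := H x.
by rewrite N0 leNgt E0.
Qed.

Lemma esum_mul_le (R : realType) (T : choiceType) (J : set T) (k : R)
    (f : T -> \bar R) : 0 <= k -> (forall x, 0 <= f x)%E ->
  (\esum_(x in J) (k%:E * f x) <= k%:E * \esum_(x in J) f x)%E.
Proof.
move=> k0 f0; apply: ge_ereal_sup => _ [X [finX XJ] <-].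
rewrite -ge0_mule_fsumr//.
apply: lee_wpmul2l => //; apply: esum_ge.
by exists X.
Qed.

Section Gibbs.
Context {R : realType} {I : countType} {A : transition I}.
Local Notation Sigma := (mshift R A).
Variables (mu : probability Sigma R) (phi : Sigma -> R).
Variables (P : R) (K : nat -> R) (c : I -> R).
Hypothesis gibbs : local_weak_gibbs mu phi P K c.
Hypothesis inv : invariant_measure mu.
Implicit Types (x y z : Sigma).

Lemma birkhoffD m n x :
  birkhoff phi (m + n) x = birkhoff phi m x + birkhoff phi n (iter m sshift x).
Proof.
rewrite /birkhoff big_split_ord/=; congr (_ + _); apply: eq_bigr => j _.
by rewrite addnC iterD.
Qed.

Lemma cyl_gt0 n x : (0 < mu (cyl n (coords x)))%E.
Proof.
by apply: (gibbs_pos gibbs (n := n)); split; [exists x|exists (coords x)].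
Qed.

Lemma cyl_fin_num n u : mu (cyl n u) \is a fin_num.
Proof. by rewrite fin_num_measure//; exact: measurable_cyl. Qed.

Lemma fine_cyl_gt0 n x : 0 < fine (mu (cyl n (coords x))).
Proof. by rewrite fine_gt0// cyl_gt0 -ge0_fin_numE// cyl_fin_num. Qed.

Definition lncyl n x : R := ln (fine (mu (cyl n (coords x)))).

Lemma cyl_lncyl n x : mu (cyl n (coords x)) = (expR (lncyl n x))%:E.
Proof.
rewrite lnK ?posrE ?fine_cyl_gt0// fineK ?cyl_fin_num//.
Qed.

Lemma lncyl_le0 n x : lncyl n x <= 0.
Proof.
rewrite ln_le0// -lee_fin fineK ?cyl_fin_num//.
by apply: probability_le1; exact: measurable_cyl.
Qed.

(** The Gibbs inequality in logarithmic form, at one point and for all lengths at once; the first n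
    letters of z determine [cyl n.-1 (coords z)]. *)
Definition gibbs_at z := forall n, (0 < n)%N ->
  `|lncyl n.-1 z - (birkhoff phi n z - n%:R * P)| <= ln (c (coords z 0)) + ln (K n).

(** The null set in the Gibbs bound depends on the cylinder, but there are only countably many
    finite words, so a single null set serves all of them. *)
Lemma ae_gibbs_at : {ae mu, forall z, gibbs_at z}.
Proof.
(* [word] enumerates pairs of a length and a word. Numbers that encode nothing give length 0, where
   [Q] is vacuous; the default letter of [nth] is never read at the positions used. *)
pose word k := odflt (0%N, [::]) (@choice.unpickle (nat * seq I)%type k).
pose u k := nth (coords (point : Sigma) 0) (word k).2.
pose Q k z := (0 < (word k).1)%N -> cyl (word k).1.-1 (u k) z ->
  (c (u k 0%N) * K (word k).1)^-1 <=
        fine (mu (cyl (word k).1.-1 (u k))) /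
          expR (- (word k).1%:R * P + birkhoff phi (word k).1 z)
        <= c (u k 0%N) * K (word k).1.
have : {ae mu, forall z, forall k, Q k z}.
  apply: ae_foralln => k; rewrite /Q.
  have [n0|] := ltnP 0 (word k).1; last by move=> _; apply: aeW => z.
  have [ne|e0] := pselect ((cyl (word k).1.-1 (u k) : set Sigma) !=set0).
    by have := gibbs_bound gibbs n0 ne; apply: filterS => z H _.
  by apply: aeW => z _ uz; exfalso; apply: e0; exists z.
apply: filterS => z H n n0.
have := H (choice.pickle (n, mkseq (coords z) n)).
rewrite /Q /u /word choice.pickleK /=.
set v := nth _ _; have vE r : (r < n)%N -> v r = coords z r.
  by move=> rn; rewrite /v nth_mkseq.
have vz : cyl n.-1 v z.
  by move=> r; rewrite -ltnS prednK// => /vE.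
move=> /(_ n0 vz); rewrite (cylE vz) vE//.
have cK : 0 < c (coords z 0) * K n.
  rewrite mulr_gt0//.
    exact: lt_le_trans ltr01 (gibbs_c gibbs _).
  by have [K1 _] := gibbs_K gibbs n0; exact: lt_le_trans K1.
have m0 := fine_cyl_gt0 n.-1 z.
have c0 : 0 < c (coords z 0) by exact: lt_le_trans (gibbs_c gibbs _).
have K0 : 0 < K n by have [K1 _] := gibbs_K gibbs n0; exact: lt_le_trans K1.
rewrite -ler_ln ?posrE ?invr_gt0 ?divr_gt0 ?expR_gt0//.
rewrite -[X in _ && X]ler_ln ?posrE ?invr_gt0 ?divr_gt0 ?expR_gt0//.
rewrite lnV ?posrE// ln_div ?posrE ?expR_gt0// expRK lnM ?posrE// -/(lncyl _ _).
by rewrite ler_norml => /andP[h1 h2]; apply/andP; split; lra.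
Qed.

Lemma ae_gibbs_at_iter : {ae mu, forall z, forall k, gibbs_at (iter k sshift z)}.
Proof.
by apply: ae_foralln => k; apply: (ae_iter measurable_sshift inv); exact: ae_gibbs_at.
Qed.

Section Variation.
Hypothesis Vfin : (\sum_(1 <= n <oo) Vsup phi n < +oo)%E.

Let V := fine (\sum_(1 <= n <oo) Vsup phi n)%E.

Let Vsup_ge0 n : (0 <= Vsup phi n)%E.
Proof.
apply: ereal_sup_ubound; exists (point : Sigma, point : Sigma) => //=.
by rewrite subrr normr0.
Qed.

(** After j shifts the points still agree on n - j letters, so the j-th terms differ by at most
    V_(n-j); reversing the order gives a partial sum of the convergent series. *)
Lemma birkhoff_variation n x y : (forall k, (k < n)%N -> coords x k = coords y k) ->
  `|birkhoff phi n x - birkhoff phi n y| <= V.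
Proof.
move=> xy; rewrite -lee_fin fineK; last first.
  by rewrite ge0_fin_numE//; apply: nneseries_ge0.
apply: le_trans (@nneseries_lim_ge _ (Vsup phi) xpredT 1 n.+1 (fun n _ _ => Vsup_ge0 n)).
rewrite -sumrB; apply: (@le_trans _ _ (\sum_(j < n) (`|phi (iter j sshift x) -
   phi (iter j sshift y)|)%:E)%E).
  by rewrite sumEFin lee_fin ler_norm_sum.
rewrite big_add1/= big_mkord (reindex_inj rev_ord_inj)/=; apply: lee_sum => j _.
apply: ereal_sup_ubound.
exists (iter (n - j.+1) sshift x, iter (n - j.+1) sshift y) => //= k kj.
rewrite !coords_iter; apply: xy.
by rewrite addnC -ltn_subRL subKn.
Qed.

End Variation.
End Gibbs.

(** * Gurevich pressure *)

Lemma invr_nat_cvg0 (R : realType) : (n%:R^-1 : R) @[n --> \oo] --> 0.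
Proof. by rewrite -(cvg_shiftS _); exact: cvg_harmonic. Qed.

Section Gurevich.
Context {R : realType} {I : countType} {A : transition I}.
Local Notation Sigma := (mshift R A).
Implicit Types (x y z w : Sigma).

Definition periodic (i : I) n : set Sigma :=
  [set w | coords w 0 = i /\ iter n sshift w = w].

Lemma periodic_mod i n w r : (0 < n)%N -> periodic i n w ->
  coords w r = coords w (r %% n).
Proof.
move=> n0 [_ wn]; rewrite {1}(divn_eq r n).
elim: (r %/ n)%N => [|k IH]; first by rewrite mul0n add0n.
by rewrite -IH -[in RHS]wn coords_iter mulSn -addnA addnC.
Qed.

Lemma periodic_loop i n z : (0 < n)%N -> coords z 0 = i -> coords z n = i ->
  exists2 w, periodic i n w & cyl n.-1 (coords w) z.
Proof.
move=> n0 z0 zn.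
pose u r := coords z (r %% n).
have uP k : A (u k) (u k.+1).
  rewrite /u modnS; case: ifP => [|_]; last exact: (proj2_sig z (k %% n)%N).
  (* At the wraparound k mod n is n - 1, and the transition needed goes from z_(n-1) to z_0 = z_n,
     hence is one of z itself. *)
  move=> nk; have -> : coords z 0 = coords z (k %% n).+1.
    rewrite z0 -zn; congr coords; apply/eqP.
    have := modnS k n; rewrite nk => _.
    have kn : (k %% n < n)%N by rewrite ltn_mod.
    rewrite eqn_leq kn andbT; rewrite leqNgt; apply/negP => kn'.
    have := nk; rewrite /dvdn -addn1 -modnDml addn1 modn_small//.
  exact: (proj2_sig z (k %% n)%N).
exists (exist _ u uP).
  split; first by rewrite /= /u mod0n.
  by apply: coords_inj; apply/funext => r; rewrite coords_iter/= /u modnDr.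
by move=> r; rewrite -ltnS prednK//= /u => rn; rewrite modn_small.
Qed.

Variables (mu : probability Sigma R) (phi : Sigma -> R).
Variables (P : R) (K : nat -> R) (c : I -> R).
Hypothesis gibbs : local_weak_gibbs mu phi P K c.
Hypothesis mix : mixing_measure mu.
Hypothesis Vfin : (\sum_(1 <= n <oo) Vsup phi n < +oo)%E.
Variable i : I.
Hypothesis i_ex : exists z, coords z 0 = i.

Let V := fine (\sum_(1 <= n <oo) Vsup phi n)%E.

(** A point of period n is determined by its first n letters, so these cylinders are pairwise
    disjoint. Encoding the words as naturals makes countable additivity applicable. *)
Lemma esum_periodic_cyl n : (0 < n)%N ->
  (\esum_(w in periodic i n) mu (cyl n.-1 (coords w)) =
  mu (\bigcup_(w in periodic i n) cyl n.-1 (coords w)))%E.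
Proof.
move=> n0.
pose e w := choice.pickle (mkseq (coords w) n).
pose F k : set Sigma := cyl n.-1 (nth i (odflt [::] (@choice.unpickle (seq I) k))).
pose Q := e @` periodic i n.
have Fe w : F (e w) = cyl n.-1 (coords w).
  rewrite /F /e choice.pickleK /=; apply: cylE => r.
  by rewrite -ltnS prednK// => rn; rewrite nth_mkseq.
have eqn w w' : periodic i n w -> periodic i n w' ->
    (forall r, (r < n)%N -> coords w r = coords w' r) -> w = w'.
  move=> pw pw' ww'; apply: coords_inj; apply/funext => r.
  by rewrite (periodic_mod _ n0 pw) (periodic_mod _ n0 pw') ww'// ltn_mod.
have einj : set_inj (periodic i n) e.
  move=> w w' /set_mem pw /set_mem pw' /(pcan_inj choice.pickleK) eqs.
  apply: (eqn) => // r rn.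
  by rewrite -(nth_mkseq i (coords w) rn) -(nth_mkseq i (coords w') rn) eqs.
have ebij : set_bij (periodic i n) Q e.
  split=> //; first by move=> w pw; exists w.
under eq_esum do rewrite -Fe.
rewrite -(reindex_esum _ _ _ (fun k => mu (F k)) ebij).
rewrite (_ : \bigcup_(w in _) _ = \bigcup_(k in Q) F k); last first.
  by rewrite bigcup_image; apply: eq_bigcupr => w _; rewrite Fe.
rewrite measure_bigcup; last 2 first.
- by move=> k _; exact: measurable_cyl.
- move=> _ _ [w pw <-] [w' pw' <-]; rewrite !Fe => -[z [zw zw']].
  congr e; apply: (eqn) => // r rn.
  have rn' : (r <= n.-1)%N by rewrite -ltnS prednK.
  by rewrite -(zw r rn') (zw' r rn').
rewrite nneseries_esum//; congr esum; apply/funext => k /=.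
by rewrite in_setE.
Qed.

Let Cst n := ln (c i) + ln (K n) + V.

(** A periodic point may lie in the exceptional null set of the Gibbs bound. A Gibbs point of the
    same cylinder replaces it, at the cost of the distortion V. *)
Lemma periodic_birkhoff n w : (0 < n)%N -> periodic i n w ->
  `|lncyl mu n.-1 w - (birkhoff phi n w - n%:R * P)| <= Cst n.
Proof.
move=> n0 pw.
have [z wz /(_ n n0)] := ae_exists (ae_gibbs_at gibbs) (measurable_cyl n.-1 (coords w))
  (cyl_gt0 gibbs n.-1 w).
have cz : cyl n.-1 (coords z) = cyl n.-1 (coords w) :> set Sigma by rewrite (cylE wz).
rewrite /lncyl cz -/(lncyl _ _ _) wz// pw.1.
have : `|birkhoff phi n w - birkhoff phi n z| <= V.
  apply: birkhoff_variation => // k kn.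
  by rewrite wz// -ltnS prednK.
by rewrite /Cst !ler_norml => /andP[h1 h2] /andP[h3 h4]; apply/andP; split; lra.
Qed.

Let Z n : \bar R := (\esum_(w in periodic i n) (expR (birkhoff phi n w))%:E)%E.

Lemma bigcup_periodic_measurable n :
  measurable (\bigcup_(w in periodic i n) cyl n.-1 (coords w) : set Sigma).
Proof.
apply: sub_sigma_algebra.
apply: bigcup_open => w _; exact: open_cyl.
Qed.

(** Each summand is comparable to the measure of a cylinder, and the disjoint cylinders have total
    measure at most 1. *)
Lemma periodic_sum_le n : (0 < n)%N -> (Z n <= (expR (n%:R * P + Cst n))%:E)%E.
Proof.
move=> n0.
apply: (@le_trans _ _ (\esum_(w in periodic i n) ((expR (n%:R * P + Cst n))%:E *
   mu (cyl n.-1 (coords w))))%E).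
  apply: le_esum => w pw; rewrite (cyl_lncyl gibbs) -EFinM lee_fin -expRD ler_expR.
  have := periodic_birkhoff n0 pw; rewrite ler_norml => /andP[h1 h2]; lra.
apply: (le_trans (esum_mul_le (periodic i n) (expR_ge0 _) _)) => //.
rewrite esum_periodic_cyl// -[leRHS]mule1; apply: lee_wpmul2l.
  by rewrite lee_fin expR_ge0.
apply: probability_le1; apply: bigcup_periodic_measurable.
Qed.

(** A point that starts at i and is back at i at time n shares its first n letters with a periodic
    point, so the cylinders of the periodic points cover the returning set. *)
Lemma periodic_sum_ge n : (0 < n)%N ->
  (mu (cyl 0 (fun=> i) `&` iter n sshift @^-1` cyl 0 (fun=> i)) *
   (expR (n%:R * P - Cst n))%:E <= Z n)%E.
Proof.
move=> n0.
set M := mu _.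
suff H : (M <= (expR (- (n%:R * P - Cst n)))%:E * Z n)%E.
  rewrite muleC; apply: le_trans (lee_wpmul2l _ H) _; first by rewrite lee_fin expR_ge0.
  by rewrite muleA -EFinM -expRD subrr expR0 mul1e.
apply: (@le_trans _ _ (mu (\bigcup_(w in periodic i n) cyl n.-1 (coords w)))).
  apply: le_measure.
  - apply: mem_set; apply: measurableI; first exact: measurable_cyl.
    apply: (measurable_iter_preimage measurable_sshift); exact: measurable_cyl.
  - apply: mem_set; exact: bigcup_periodic_measurable.
  - move=> z [z0 zn]; have zn' : coords z n = i.
      by have := zn 0%N (leqnn _); rewrite coords_iter add0n.
    have [w pw wz] := periodic_loop n0 (z0 0%N (leqnn _)) zn'.
    by exists w.
rewrite -esum_periodic_cyl//.
apply: le_trans (esum_mul_le (periodic i n) (expR_ge0 _) _); last first.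
  by move=> w; rewrite lee_fin expR_ge0.
apply: le_esum => w pw; rewrite (cyl_lncyl gibbs) -EFinM lee_fin -expRD ler_expR.
have := periodic_birkhoff n0 pw; rewrite ler_norml => /andP[h1 h2]; lra.
Qed.

Theorem gurevich_pressureE : gurevich_pressure phi i = P%:E.
Proof.
have [x xi] := i_ex.
set C := cyl 0 (fun=> i) : set Sigma.
have CE : C = cyl 0 (coords x).
  by apply: cylE => r; rewrite leqn0 => /eqP ->.
have mC : measurable C by exact: measurable_cyl.
have C0 : 0 < fine (mu C) by rewrite CE (fine_cyl_gt0 gibbs).
(* Half of the limit mu(C)^2 given by mixing: the returning set eventually has measure above k, and
   ln k / n tends to 0. *)
set k := fine (mu C) ^+ 2 / 2.
have k0 : 0 < k by rewrite divr_gt0// exprn_gt0.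
have mixC : \forall n \near \oo, (k%:E < mu (C `&` iter n sshift @^-1` C))%E.
  apply: (mix mC mC (open_ereal_gt' _)).
  rewrite -[mu C]fineK ?fin_num_measure// -EFinM lte_fin /k -expr2.
  by rewrite ltr_pdivrMr// ltr_pMr ?exprn_gt0// ltr1n.
have Cst0 : (n%:R^-1 * Cst n) @[n --> \oo] --> 0.
  rewrite (_ : (fun n => _) = (fun n => (ln (c i) + V) * n%:R^-1 + ln (K n) / n%:R)); last first.
    by apply/funext => n; rewrite /Cst; ring.
  rewrite -[X in _ --> X]addr0; apply: cvgD; last exact: gibbs_K_subexp gibbs.
  rewrite -[X in _ --> X](mulr0 (ln (c i) + V)); apply: cvgMr.
  exact: invr_nat_cvg0.
have inv0 : (n%:R^-1 : R) @[n --> \oo] --> 0 by exact: invr_nat_cvg0.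
apply/cvg_lim => //.
apply: (@squeeze_cvge _ _ _ _ (fun n => (P + (n%:R^-1 * ln k - n%:R^-1 * Cst n))%:E) _
    (fun n => (P + n%:R^-1 * Cst n)%:E)).
- apply: filterS2 (nbhs_infty_gt 0) mixC => n n0 kn.
  have n0' : n%:R != 0 :> R by rewrite pnatr_eq0 -lt0n.
  have up := periodic_sum_le n0.
  have lo : ((expR (ln k + (n%:R * P - Cst n)))%:E <= Z n)%E.
    apply: le_trans (periodic_sum_ge n0); rewrite expRD lnK ?posrE// EFinM.
    by apply: lee_wpmul2r; [rewrite lee_fin expR_ge0|exact: ltW].
  rewrite -/(Z n); case: (Z n) up lo => [z| |//]; rewrite ?lee_fin// => up lo.
  have z0 : 0 < z by apply: lt_le_trans lo; exact: expR_gt0.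
  rewrite lne_EFin// -EFinM !lee_fin.
  have up' : ln z <= n%:R * P + Cst n by rewrite -ler_expR lnK.
  have lo' : ln k + (n%:R * P - Cst n) <= ln z by rewrite -ler_expR lnK.
  have n1 : 0 <= n%:R^-1 :> R by rewrite invr_ge0.
  apply/andP; split.
    apply: le_trans (ler_wpM2l n1 lo'); rewrite le_eqVlt; apply/orP; left.
    by apply/eqP; field.
  apply: (le_trans (ler_wpM2l n1 up')); rewrite le_eqVlt; apply/orP; left.
  by apply/eqP; field.
- apply: cvg_EFin; first exact: nearW.
  rewrite -[X in _ --> X]addr0; apply: cvgD; first exact: cvg_cst.
  rewrite -[X in _ --> X]subr0; apply: cvgB => //.
  by rewrite -[X in _ --> X](mul0r (ln k)); apply: cvgMl.
- apply: cvg_EFin; first exact: nearW.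
  by rewrite -[X in _ --> X]addr0; apply: cvgD => //; exact: cvg_cst.
Qed.

End Gurevich.

(** * Covers by cylinders *)

Lemma esum_le_subset (R : realType) (T : choiceType) (J L : set T)
    (f : T -> \bar R) : J `<=` L ->
  (\esum_(x in J) f x <= \esum_(x in L) f x)%E.
Proof.
move=> JL; apply: ereal_sup_le => _ [X [finX XJ] <-].
by exists X => //; split => // x /XJ/JL.
Qed.

Lemma measure_bigcup_le d (T : measurableType d) (R : realType)
    (mu : {measure set T -> \bar R}) (J : set nat) (F : nat -> set T) :
  (forall j, J j -> measurable (F j)) ->
  (mu (\bigcup_(j in J) F j) <= \esum_(j in J) mu (F j))%E.
Proof.
move=> mF; rewrite esum_mkcond.
rewrite -nneseries_esumT; last by move=> n; case: ifP.
rewrite (eq_eseriesr (g := fun n => mu (if n \in J then F n else set0))); last first.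
  by move=> n _; case: ifP => // _; rewrite measure0.
apply: measure_sigma_subadditive.
- by move=> n; case: ifPn => // /set_mem; exact: mF.
- exact: bigcup_measurable.
- by move=> x [j Jj Fx]; exists j => //; rewrite mem_set.
Qed.

Section Covers.
Context {R : realType} {I : countType} {A : transition I}.
Local Notation Sigma := (mshift R A).
Implicit Types (x y z w : Sigma).
Variables (mu : probability Sigma R) (phi : Sigma -> R).
Variables (P : R) (K : nat -> R) (c : I -> R).
Hypothesis gibbs : local_weak_gibbs mu phi P K c.
Hypothesis inv : invariant_measure mu.

Lemma le_lncyl n m x y : (cyl n (coords x) : set Sigma) `<=` cyl m (coords y) ->
  lncyl mu n x <= lncyl mu m y.
Proof.
move=> xy; rewrite ler_ln ?posrE ?(fine_cyl_gt0 gibbs)//.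
apply: fine_le; [exact: cyl_fin_num|exact: cyl_fin_num|].
by apply: le_measure => //; apply: mem_set; exact: measurable_cyl.
Qed.

(* The three Gibbs bounds are taken along the orbit of one point, so that the
   Birkhoff sums cancel exactly and no distortion term appears. *)
Lemma lncyl_concat k l x : (0 < k)%N ->
  lncyl mu k.-1 x + lncyl mu l (iter k sshift x) -
    (2 * ln (c (coords x 0)) + ln (c (coords x k)) +
     (ln (K k) + ln (K l.+1) + ln (K (k + l.+1)))) <=
  lncyl mu (k + l) x.
Proof.
move=> k0.
have [z xz gz] := ae_exists (ae_gibbs_at_iter gibbs inv)
  (measurable_cyl (k + l) (coords x)) (cyl_gt0 gibbs _ x).
have eqz m r : (m + r <= k + l)%N ->
    lncyl mu m (iter r sshift z) = lncyl mu m (iter r sshift x).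
  move=> mr; rewrite /lncyl (@cylE _ _ _ m (coords (iter r sshift z)) (iter r sshift x))//.
  move=> j jm; rewrite !coords_iter xz//.
  by rewrite (leq_trans _ mr)// leq_add2r.
have := gz 0%N k k0; have := gz k l.+1 (ltn0Sn _).
have := gz 0%N (k + l.+1)%N; rewrite addnS => /(_ (ltn0Sn _)).
rewrite /= -addnS birkhoffD.
rewrite -[z in lncyl mu (k + l) z]/(iter 0 sshift z) (eqz (k + l)%N 0%N) ?addn0//.
rewrite -[z in lncyl mu k.-1 z]/(iter 0 sshift z) (eqz k.-1 0%N); last first.
  by rewrite addn0 (leq_trans (leq_pred _))// leq_addr.
rewrite eqz; last by rewrite addnC.
rewrite coords_iter add0n !xz ?leq_addr// natrD.
rewrite !ler_norml => /andP[h1 h2] /andP[h3 h4] /andP[h5 h6] /=; lra.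
Qed.

Variables (D : set nat) (Cs : nat -> set Sigma) (a : R).
Hypothesis cylD : forall i, D i -> exists n, is_cylinder n (Cs i).
Hypothesis a01 : 0 <= a < 1.

Definition content_in (F : set Sigma) : \bar R :=
  (\esum_(i in [set i | D i /\ Cs i `<=` F]) (poweR (mu (Cs i)) a))%E.

Lemma content_in_le F G : F `<=` G -> (content_in F <= content_in G)%E.
Proof.
by move=> FG; apply: esum_le_subset => i [Di CF]; split => //; exact: subset_trans FG.
Qed.

Lemma poweR_cyl n x :
  (poweR (mu (cyl n (coords x))) a = (expR (a * lncyl mu n x))%:E)%E.
Proof. by rewrite (cyl_lncyl gibbs) poweR_EFin -expRM mulrC. Qed.

Lemma is_cylinderE n (C : set Sigma) z : is_cylinder n C -> C z ->
  C = cyl n (coords z).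
Proof. by move=> [_ [u ->]]; exact: cylE. Qed.

Lemma content_in_ge i F : D i -> Cs i `<=` F ->
  (poweR (mu (Cs i)) a <= content_in F)%E.
Proof.
move=> Di CF; rewrite -(@esum_set1 R nat i (fun i => poweR (mu (Cs i)) a)) ?poweR_ge0//.
by apply: esum_le_subset => j ->.
Qed.

(** For C_i inside the cylinder F, mu(C_i) = mu(C_i)^(1-a) mu(C_i)^a <= mu(F)^(1-a) mu(C_i)^a; sum
    over i. *)
Lemma small_covered_measure_le n x :
  (mu (\bigcup_(i in [set i | D i /\ Cs i `<=` cyl n (coords x)]) Cs i)
  <= (expR ((1 - a) * lncyl mu n x))%:E * content_in (cyl n (coords x)))%E.
Proof.
have mCs i : D i -> measurable (Cs i).
  by move=> /cylD[m [_ [u ->]]]; exact: measurable_cyl.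
apply: le_trans (measure_bigcup_le _ _) _; first by move=> i [/mCs].
apply: le_trans (esum_mul_le _ (expR_ge0 _) _); last first.
  by move=> i; exact: poweR_ge0.
apply: le_esum => i [Di Cx].
have [m cm] := cylD Di; have [[z Cz] _] := cm.
move: Cx; rewrite (is_cylinderE cm Cz) => zx.
rewrite poweR_cyl [leLHS](cyl_lncyl gibbs) -EFinM lee_fin -expRD ler_expR.
have := le_lncyl zx; case/andP: a01 => a0 a1.
rewrite -subr_ge0 => h; rewrite -subr_ge0.
rewrite (_ : _ - _ = (1 - a) * (lncyl mu n x - lncyl mu m z)); last by ring.
by rewrite mulr_ge0// subr_ge0 ltW.
Qed.

(** Each heavy cylinder G satisfies mu(G) <= content(G) / B. Distinct G of the same length are
    disjoint and each C_i is nonempty, so no C_i is counted twice in the sum. *)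
Lemma heavy_cylinders_measure_le k (B : R) (F : set Sigma) : (0 < k)%N -> 0 < B ->
  (mu (\bigcup_(z in [set z : Sigma | (cyl k.-1 (coords z) : set Sigma) `<=` F /\
      (B%:E * mu (cyl k.-1 (coords z)) <= content_in (cyl k.-1 (coords z)))%E])
      cyl k.-1 (coords z))
    <= B^-1%:E * content_in F)%E.
Proof.
move=> k0 B0; set Z := [set z | _].
pose G j : set Sigma := cyl k.-1 (nth (coords (point : Sigma) 0)
  (odflt [::] (@choice.unpickle (seq I) j))).
pose e z := choice.pickle (mkseq (coords z) k).
have Ge z : G (e z) = cyl k.-1 (coords z).
  rewrite /G /e choice.pickleK /=; apply: cylE => r.
  by rewrite -ltnS prednK// => rk; rewrite nth_mkseq.
pose J := e @` Z.
pose S j := [set i | J j /\ (D i /\ Cs i `<=` G j)].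
rewrite (_ : \bigcup_(z in Z) _ = \bigcup_(j in J) G j); last first.
  by rewrite bigcup_image; apply: eq_bigcupr => z _; rewrite Ge.
apply: le_trans (measure_bigcup_le _ _) _; first by move=> j _; exact: measurable_cyl.
apply: (@le_trans _ _ (\esum_(j in J) (B^-1%:E *
    \esum_(i in S j) poweR (mu (Cs i)) a))%E).
  apply: le_esum => j Jj.
  rewrite (_ : S j = [set i | D i /\ Cs i `<=` G j]); last first.
    by apply/seteqP; split => i; [case|split].
  case: Jj => z [_ zB] <-; rewrite Ge.
  rewrite -[leLHS]mul1e -(mulVf (lt0r_neq0 B0)) EFinM -muleA.
  by apply: lee_wpmul2l => //; rewrite lee_fin invr_ge0 ltW.
have Binv : 0 <= B^-1 by rewrite invr_ge0 ltW.
apply: le_trans (esum_mul_le _ Binv _) _.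
  by move=> j; apply: esum_ge0 => i _; exact: poweR_ge0.
apply: lee_wpmul2l; first by rewrite lee_fin.
rewrite -esum_bigcupT; last 2 first.
- move=> j j' _ _ [i [[[z _ zj] [Di Cj]] [[z' _ zj'] [_ Cj']]]].
  have [m [[y Cy] _]] := cylD Di.
  move: (Cj _ Cy) (Cj' _ Cy); rewrite -zj -zj' !Ge => yz yz'.
  congr choice.pickle; apply/eq_in_map => r; rewrite mem_iota add0n => /andP[_ rk].
  have rk' : (r <= k.-1)%N by rewrite -ltnS prednK.
  by rewrite -(yz r rk') (yz' r rk').
- by move=> i; exact: poweR_ge0.
apply: esum_le_subset => i [j _ [[z [zF _] <-] [Di CG]]]; split => //.
by apply: subset_trans CG _; rewrite Ge.
Qed.

End Covers.

(** * Points escaping a cheap cover *)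

Lemma unbounded_infinite_set (S : set nat) :
  (forall M, exists2 k, (M <= k)%N & S k) -> infinite_set S.
Proof.
move=> unb /finite_fsetP[X SX].
have [k Mk] := unb (\max_(i <- X) i).+1; rewrite SX => kX.
by move: Mk; rewrite ltnNge leq_bigmax_seq.
Qed.

Lemma measurable_deviation d (T : measurableType d) (R : realType)
    (mu : probability T R) (S : T -> T) (f : T -> R) (k : nat) (e p : R) :
  measurable_fun setT S -> mu.-integrable setT (EFin \o f) ->
  measurable [set x | e <= `|k%:R^-1 * (\sum_(j < k) f (iter j S x)) - p|]%R.
Proof.
move=> mS intf.
have mf : measurable_fun setT f.
  by apply/measurable_EFinP; exact: measurable_int intf.
set g := fun x => `|k%:R^-1 * (\sum_(j < k) f (iter j S x)) - p|.
have mg : measurable_fun setT g.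
  by apply: measurableT_comp => //; exact: measurable_average.
rewrite (_ : [set x | _] = [set: T] `&` g @^-1` `[e, +oo[%classic).
  exact: mg.
by rewrite setTI; apply/seteqP; split => y /=; rewrite in_itv/= andbT.
Qed.

Section Construction.
Context {R : realType} {I : countType} {A : transition I}.
Local Notation Sigma := (mshift R A).
Implicit Types (x y z : Sigma).
Variables (mu : probability Sigma R) (phi : Sigma -> R).
Variables (P : R) (K : nat -> R) (c : I -> R).
Hypothesis gibbs : local_weak_gibbs mu phi P K c.
Hypothesis inv : invariant_measure mu.
Hypothesis mix : mixing_measure mu.
Hypothesis phi_int : mu.-integrable setT (EFin \o phi).
Variables (l : nat -> nat) (w : Sigma) (a s : R).
Let m := fine (\int[mu]_x (phi x)%:E)%E.
(** The index is the number of letters of the longest word in the Gibbs bounds of one step; K being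
    nondecreasing, it controls the shorter ones too. *)
Hypothesis K_small : forall e : R, 0 < e ->
  \forall k \near \oo, ln (K (k + (l k).+1)) <= e * k%:R.
Hypothesis target_large : forall e : R, 0 < e ->
  \forall k \near \oo, - (k%:R * (s + e)) <= lncyl mu (l k) w.
Hypothesis a01 : 0 <= a < 1.
(** With h = P - m this is a (h + s) < h. *)
Hypothesis a_lt : a * s < (1 - a) * (P - m).
Variables (D : set nat) (Cs : nat -> set Sigma).
Hypothesis cylD : forall i, D i -> exists n, is_cylinder n (Cs i).

(* In a cylinder F the points entering the first letter of w at a large time fill
   a proportion 4 * threshold of F; each of the three exceptional sets of
   [one_step] fills at most a proportion threshold. *)
Definition threshold : R := fine (mu (cyl 0 (coords w))) / 4.

Definition uncovered n x :=
  (forall i, D i -> ~ (cyl n (coords x) `<=` Cs i)) /\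
  (content_in mu D Cs a (cyl n (coords x)) <
     threshold%:E * poweR (mu (cyl n (coords x))) a)%E.

Lemma threshold_gt0 : 0 < threshold.
Proof. by rewrite divr_gt0// (fine_cyl_gt0 gibbs). Qed.

Lemma threshold_le1 : threshold <= 1.
Proof.
rewrite /threshold ler_pdivrMr// mul1r; apply: (@le_trans _ _ 1); last by rewrite ler1n.
rewrite -lee_fin fineK ?cyl_fin_num//.
by apply: probability_le1; exact: measurable_cyl.
Qed.

Lemma gibbs_K_le n p : (0 < n)%N -> (n <= p)%N -> ln (K n) <= ln (K p).
Proof.
move=> n0; elim: p => [|p IH]; first by rewrite leqn0 => /eqP <-.
rewrite leq_eqVlt => /predU1P[<-//|]; rewrite ltnS => np.
have p0 : (0 < p)%N by exact: leq_trans np.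
apply: le_trans (IH np) _; have [K1 KS] := gibbs_K gibbs p0.
have Kp : 0 < K p by exact: lt_le_trans ltr01 K1.
by rewrite ler_ln ?posrE//; exact: lt_le_trans KS.
Qed.

(** The gap (1 - a)(P - m) - a s equals 8 e. The errors linear in k, coming from K, from the
    Birkhoff sum and from the target, use up at most 4 e k of the gain 8 e k; the remaining 4 e k
    outweighs C, which collects the terms independent of k. *)
Lemma target_cylinder_weight (lF : R) x k z x' :
  let e := ((1 - a) * (P - m) - a * s) / 8 in
  let C := ln threshold + (1 - a) * lF - a * (2 * ln (c (coords x 0)) +
     ln (c (coords w 0))) - (1 - a) * ln (c (coords x 0)) in
  (0 < k)%N -> - C <= 4 * e * k%:R ->
  ln (K (k + (l k).+1)) <= e * k%:R ->
  - (k%:R * (s + e)) <= lncyl mu (l k) w ->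
  coords z 0 = coords x 0 -> gibbs_at mu phi P K c z ->
  `|k%:R^-1 * birkhoff phi k z - m| < e ->
  (forall r, (r <= k)%N -> coords x' r = coords z r) -> iter k sshift x' = w ->
  expR ((a - 1) * lF) * expR (lncyl mu k.-1 z) <=
  threshold * expR (a * lncyl mu (k + l k) x').
Proof.
move=> e C k0 Ck Kk Lk zx gz zk xz xw.
have k0' : 0 < k%:R :> R by rewrite ltr0n.
case/andP: a01 => a0 a1.
have e0 : 0 < e by rewrite divr_gt0// subr_gt0.
have e8 : 8 * e = (1 - a) * (P - m) - a * s by rewrite /e; field.
clearbody e.
have Sk : birkhoff phi k z <= k%:R * (m + e).
  rewrite -ler_pdivrMl// ; move: zk; rewrite ltr_norml => /andP[_ h]; lra.
have GG : lncyl mu k.-1 x' = lncyl mu k.-1 z.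
  rewrite /lncyl (@cylE _ _ _ k.-1 (coords x') z)// => r rk.
  by rewrite xz// (leq_trans rk (leq_pred k)).
have := lncyl_concat gibbs inv (l k) x' k0.
rewrite xw GG !xz// zx.
have -> : coords z k = coords w 0 by rewrite -xw coords_iter add0n xz.
have Kk1 : ln (K k) <= e * k%:R.
  by apply: le_trans Kk; apply: gibbs_K_le => //; exact: leq_addr.
have Kl1 : ln (K (l k).+1) <= e * k%:R.
  by apply: le_trans Kk; apply: gibbs_K_le => //; exact: leq_addl.
have := gz k k0; rewrite zx ler_norml => /andP[_].
set lG := lncyl mu k.-1 z; set l' := lncyl mu _ x'; set lc := ln (c (coords x 0)).
set lcw := ln (c (coords w 0)); set lC := lncyl mu (l k) w.
move=> hG h'.
have hG' : lG <= lc + 2 * (e * k%:R) + k%:R * m - k%:R * P by lra.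
have h'' : lG + lC - (2 * lc + lcw + 3 * (e * k%:R)) <= l' by lra.
rewrite -[threshold]lnK ?posrE ?threshold_gt0// -!expRD ler_expR.
have h1 := ler_wpM2l a0 h''.
have a1' : 0 <= 1 - a by rewrite subr_ge0 ltW.
have h2 := ler_wpM2l a1' hG'.
have h3 := ler_wpM2l a0 Lk.
have h4 : 0 <= (1 - a) * (e * k%:R) by rewrite mulr_ge0// mulr_ge0// ltW.
have h5 : 8 * (e * k%:R) = ((1 - a) * (P - m) - a * s) * k%:R by rewrite mulrA e8.
move: Ck; rewrite /C -/lc -/lcw -/lC => Ck.
move: h1 h2 h3 h4 h5 Ck; rewrite -/lC; clear; move=> h1 h2 h3 h4 h5 Ck.
lra.
Qed.


(* A point of F that starts a copy of w at time k yields a cylinder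
   G = cyl k.-1 z and, inside it, the cylinder of the points that follow w from
   time k on.  If the latter is not uncovered then z lies in a covering set inside
   F (in E1) or the covering content of G is large compared with mu G (z is in
   E2).  Points with an atypical Birkhoff sum form E3. *)
Lemma one_step n x : uncovered n x -> exists k x',
  [/\ (n < k)%N, (cyl (k + l k) (coords x') : set Sigma) `<=` cyl n (coords x),
      iter k sshift x' = w & uncovered (k + l k) x'].
Proof.
move=> [nocov small].
set F := cyl n (coords x) : set Sigma; set C0 := cyl 0 (coords w) : set Sigma.
set lF := lncyl mu n x; set q := threshold.
have muF : mu F = (expR lF)%:E by exact: (cyl_lncyl gibbs).
have muC0 : mu C0 = (4 * q)%:E.
  by rewrite -[LHS]fineK ?cyl_fin_num//; congr EFin; rewrite /q /threshold; field.
have q0 : 0 < q := threshold_gt0.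
have mF : measurable F by exact: measurable_cyl.
have mC0 : measurable C0 by exact: measurable_cyl.
have qF0 : 0 < q * expR lF by rewrite mulr_gt0// expR_gt0.
set e := ((1 - a) * (P - m) - a * s) / 8.
have e0 : 0 < e by rewrite divr_gt0// subr_gt0.
set C := ln threshold + (1 - a) * lF - a * (2 * ln (c (coords x 0)) +
     ln (c (coords w 0))) - (1 - a) * ln (c (coords x 0)).
have meet : \forall k \near \oo,
    ((3 * (q * expR lF))%:E < mu (F `&` iter k sshift @^-1` C0))%E.
  apply: (mix mF mC0 (open_ereal_gt' _)); rewrite muF muC0 -EFinM lte_fin.
  by lra.
have e40 : 0 < 4 * e by rewrite mulr_gt0.
near \oo => k.
have bad : (mu [set x | e <= `|k%:R^-1 * birkhoff phi k x - m|]%R <=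
    (q * expR lF)%:E)%E.
  by near: k; exact: (weak_law measurable_sshift inv mix phi_int e0 qF0).
have mt : ((3 * (q * expR lF))%:E < mu (F `&` iter k sshift @^-1` C0))%E.
  by near: k.
have k0 : (0 < k)%N by near: k; exact: nbhs_infty_gt.
have nk : (n < k)%N by near: k; exact: nbhs_infty_gt.
have Ck : - C <= 4 * e * k%:R by near: k; exact: natr_ge_near.
have Kk : ln (K (k + (l k).+1)) <= e * k%:R by near: k; exact: K_small.
have Tk : - (k%:R * (s + e)) <= lncyl mu (l k) w by near: k; exact: target_large.
apply: contrapT => H.
have [N [mN N0 gN]] := ae_gibbs_at gibbs.
set X := F `&` iter k sshift @^-1` C0 in mt.
set E1 := \bigcup_(i in [set i | D i /\ Cs i `<=` F]) Cs i.

(* The factor mu(F)^(a-1) is the one for which the heavy cylinders have measure at most mu(F)^(1-a)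
   q mu(F)^a = q mu(F). *)
set E2 := \bigcup_(z in [set z : Sigma | (cyl k.-1 (coords z) : set Sigma) `<=` F /\
  ((expR ((a - 1) * lF))%:E * mu (cyl k.-1 (coords z)) <=
   content_in mu D Cs a (cyl k.-1 (coords z)))%E]) (cyl k.-1 (coords z) : set Sigma).
set E3 := [set x0 | e <= _]%R in bad.
have mX : measurable X.
  by apply: measurableI => //; exact: (measurable_iter_preimage measurable_sshift).
have mE1 : measurable E1.
  apply: bigcup_measurable => i [/cylD[p [_ [u ->]]] _]; exact: measurable_cyl.
have mE2 : measurable E2.
  by apply: sub_sigma_algebra; apply: bigcup_open => z _; exact: open_cyl.
have mE3 : measurable E3.
  exact: (measurable_deviation k e m measurable_sshift phi_int).
have XE : X `<=` E1 `|` (E2 `|` (E3 `|` N)).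
  move=> z [Fz Cz].
  have [Nz|Nz] := pselect (N z); first by right; right; right.
  have [E3z|E3z] := pselect (E3 z); first by right; right; left.
  have gz : gibbs_at mu phi P K c z by apply: contrapT => ngz; apply: Nz; exact: gN.
  have zw : coords z k = coords w 0.
    by have := Cz 0%N (leqnn _); rewrite coords_iter add0n.
  have [x' [xz xw]] := mshift_splice zw.
  have zF : (cyl k.-1 (coords z) : set Sigma) `<=` F.
    rewrite /F (cylE Fz); apply: subset_cyl; rewrite -ltnS prednK//.
  have xF : (cyl (k + l k) (coords x') : set Sigma) `<=` cyl n (coords x).
    rewrite (@cylE _ _ _ n (coords x) x'); last first.
      by move=> r rn; rewrite xz ?Fz// (leq_trans rn (ltnW nk)).
    by apply: subset_cyl; apply: leq_trans (ltnW nk) (leq_addr _ _).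
  have xGz : cyl k.-1 (coords x') = cyl k.-1 (coords z) :> set Sigma.
    by apply/esym/cylE => r rk; rewrite xz// (leq_trans rk (leq_pred k)).
  have xG : (cyl (k + l k) (coords x') : set Sigma) `<=` cyl k.-1 (coords z).
    by rewrite -xGz; apply: subset_cyl; rewrite (leq_trans (leq_pred k))// leq_addr.
  have heavy : (threshold%:E * poweR (mu (cyl (k + l k) (coords x'))) a <=
      content_in mu D Cs a (cyl k.-1 (coords z)))%E -> E2 z.
    move=> hv; exists z => //; split => //; apply: le_trans hv.
    rewrite (poweR_cyl gibbs) (cyl_lncyl gibbs) -!EFinM lee_fin.
    apply: (@target_cylinder_weight lF x k z x') => //.
    - exact: (Fz 0%N (leq0n _)).
    - by rewrite ltNge; apply/negP.
  have : ~ uncovered (k + l k) x' by move=> ux; apply: H; exists k, x'.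
  (* Either some C_i contains the new cylinder, or its content is too large; in the second case G,
     which contains it, is heavy. *)
  move=> /not_andP[/existsNP[i /not_implyP[Di /contrapT Cx]]|/negP]; last first.
    rewrite -leNgt => hx; right; left; apply: heavy.
    by apply: (le_trans hx); exact: content_in_le.
  have [p cp] := cylD Di.
  have CE := is_cylinderE cp (Cx x' (@cylxx _ _ _ (k + l k)%N x')).
  (* If C_i is fixed by the first k letters, it contains z and is nested with F: lying inside F puts
     z in [E1], and containing F is excluded by the invariant. Otherwise C_i lies inside G. *)
  have [pk|kp] := leqP p k.-1.
    have xzp r : (r <= p)%N -> coords x' r = coords z r.
      by move=> rp; rewrite xz// (leq_trans rp)// (leq_trans pk (leq_pred k)).
    have CzE : Cs i = cyl p (coords z).
      by rewrite CE; apply: cylE => r rp; rewrite xzp.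
    left; exists i; last by rewrite CzE.
    split => //; have [np|pn] := leqP n p.
      by rewrite CzE /F (cylE Fz); exact: subset_cyl.
    exfalso; apply: (nocov i Di); rewrite (cylE Fz) CzE.
    exact: subset_cyl (ltnW pn).
  (* C_i alone makes G heavy: it contains the new cylinder F', so mu(C_i)^a >= mu(F')^a >= q
     mu(F')^a because q <= 1. *)
  right; left; apply: heavy.
  apply: (@le_trans _ _ (poweR (mu (Cs i)) a)).
    rewrite CE !(poweR_cyl gibbs) -EFinM lee_fin.
    apply: le_trans (ler_wpM2r (expR_ge0 _) threshold_le1) _.
    rewrite mul1r ler_expR; apply: ler_wpM2l; first by case/andP: a01.
    apply: (le_lncyl gibbs); rewrite -CE; exact: Cx.
  apply: content_in_ge => //; rewrite CE -xGz; exact/subset_cyl/ltnW.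
have mu1 : (mu E1 <= (q * expR lF)%:E)%E.
  apply: le_trans (small_covered_measure_le gibbs cylD a01 n x) _.
  apply: le_trans (lee_wpmul2l _ (ltW small)) _; first by rewrite lee_fin expR_ge0.
  rewrite (poweR_cyl gibbs) -!EFinM lee_fin -/lF mulrCA -expRD ler_pM2l//.
  by rewrite ler_expR le_eqVlt; apply/orP; left; apply/eqP; ring.
have mu2 : (mu E2 <= (q * expR lF)%:E)%E.
  apply: le_trans (heavy_cylinders_measure_le mu _ cylD F k0 (expR_gt0 _)) _.
  apply: le_trans (lee_wpmul2l _ (ltW small)) _; first by rewrite lee_fin invr_ge0 expR_ge0.
  rewrite (poweR_cyl gibbs) -!EFinM lee_fin -/lF mulrCA -expRN -expRD ler_pM2l//.
  by rewrite ler_expR le_eqVlt; apply/orP; left; apply/eqP; ring.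
suff : (mu X <= (3 * (q * expR lF))%:E)%E by rewrite leNgt mt.
have mN3 := measurableU _ _ mE3 mN.
have mN2 := measurableU _ _ mE2 mN3.
apply: (@le_trans _ _ (mu (E1 `|` (E2 `|` (E3 `|` N))))).
  by apply: le_measure => //; apply: mem_set => //; exact: measurableU.
apply: le_trans (measureU2 _ mE1 mN2) _.
have -> : 3 * (q * expR lF) = q * expR lF + (q * expR lF + (q * expR lF + 0)) by ring.
rewrite !EFinD; apply: leeD => //.
apply: le_trans (measureU2 _ mE2 mN3) _; apply: leeD => //.
apply: le_trans (measureU2 _ mE3 mN) _; apply: leeD => //.
by rewrite [leLHS]N0.
Unshelve. all: by end_near. Qed.

Lemma escape n x : uncovered n x -> exists z,
  [/\ cyl n (coords x) z,
      infinite_set [set k | cyl (l k) (coords w) (iter k sshift z)] &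
      forall i, D i -> ~ Cs i z].
Proof.
move=> unc.
pose state := {p : nat * Sigma | uncovered p.1 p.2}.
pose rk (t : state) := (proj1_sig t).1.
pose pt (t : state) := (proj1_sig t).2.
have /choice[next nextP] : forall t : state, exists t' : state, exists k,
    [/\ (rk t < k)%N, rk t' = (k + l k)%N,
      (cyl (rk t') (coords (pt t')) : set Sigma) `<=` cyl (rk t) (coords (pt t)) &
      iter k sshift (pt t') = w].
  move=> t; have [k [y [tk yt yw unc']]] := one_step (proj2_sig t).
  by exists (exist _ ((k + l k)%N, y) unc'), k.
pose t0 : state := exist _ (n, x) unc.
pose st j := iter j next t0.
have stP j : exists k, [/\ (rk (st j) < k)%N, rk (st j.+1) = (k + l k)%N,
      (cyl (rk (st j.+1)) (coords (pt (st j.+1))) : set Sigma) `<=`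
        cyl (rk (st j)) (coords (pt (st j))) &
      iter k sshift (pt (st j.+1)) = w] by exact: nextP.
have rk_ge j : (j <= rk (st j))%N.
  elim: j => // j IH; have [k [kj -> _ _]] := stP j.
  by apply: (leq_trans (leq_ltn_trans IH kj)); exact: leq_addr.
have nested i j : (i <= j)%N ->
    (cyl (rk (st j)) (coords (pt (st j))) : set Sigma) `<=`
    cyl (rk (st i)) (coords (pt (st i))).
  elim: j => [|j IH]; first by rewrite leqn0 => /eqP ->.
  rewrite leq_eqVlt => /predU1P[->//|]; rewrite ltnS => /IH; apply: subset_trans.
  by have [k []] := stP j.
have ptE i j r : (i <= j)%N -> (r <= rk (st i))%N ->
    coords (pt (st j)) r = coords (pt (st i)) r.
  by move=> ij ri; apply: (nested _ _ ij) => //; exact: cylxx.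
(* The limit point is read off diagonally: stage r has rank at least r, so its coordinate r is
   shared by all later stages. *)
pose u r := coords (pt (st r)) r.
have uE j r : (r <= rk (st j))%N -> u r = coords (pt (st j)) r.
  move=> rj; have [jr|/ltnW rj'] := leqP j r; first exact: ptE.
  by rewrite /u (ptE r j)//.
have uP k : A (u k) (u k.+1).
  rewrite (uE k.+1) ?(uE k.+1 k.+1)//; last by rewrite (leq_trans (leqnSn k)).
  exact: (proj2_sig (pt (st k.+1)) k).
pose z : Sigma := exist _ u uP.
have zst j : cyl (rk (st j)) (coords (pt (st j))) z by move=> r rj; exact: uE.
exists z; split; first exact: (zst 0%N).
- apply: unbounded_infinite_set => M.
  (* Stage M + 1 fixes the coordinates up to k + l k, so from time k on the limit point copies w as
     far as the target requires; moreover k > M. *)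
  have [k [Mk rkE _ yw]] := stP M.
  exists k; first exact: (leq_trans (rk_ge M) (ltnW Mk)).
  move=> r rl; rewrite coords_iter (zst M.+1); last by rewrite rkE addnC leq_add2l.
  by rewrite -yw coords_iter.
(* A C_i of rank p through z would contain the cylinder of stage p, whose rank is at least p; the
   invariant forbids this. *)
- move=> i Di Cz; have [p cp] := cylD Di.
  have [nocov _] := proj2_sig (st p).
  apply: (nocov i Di); rewrite (is_cylinderE cp Cz).
  by rewrite (cylE (zst p)); apply: subset_cyl; exact: rk_ge.
Qed.

End Construction.

(** * Asymptotic inputs of the construction and the limit defining the dimension *)

Section Estimates.
Context {R : realType} {I : countType} {A : transition I}.
Local Notation Sigma := (mshift R A).
Implicit Types (x y z : Sigma).
Variables (mu : probability Sigma R) (phi : Sigma -> R).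
Variables (P : R) (K : nat -> R) (c : I -> R).
Hypothesis gibbs : local_weak_gibbs mu phi P K c.
Hypothesis inv : invariant_measure mu.

Lemma lnK_sublinear (e : R) : 0 < e ->
  \forall n \near \oo, ln (K n) <= e * n%:R.
Proof.
move=> e0; have := gibbs_K_subexp gibbs => /(cvgr_le 0) /(_ _ e0).
apply: filterS2 (nbhs_infty_gt 0) => n n0.
by rewrite ler_pdivrMr// ltr0n.
Qed.

(** If the integral exceeded P, a point with typical Birkhoff sums would by the Gibbs bound lie in a
    cylinder of measure greater than 1. *)
Lemma entropy_ge0 : mixing_measure mu -> mu.-integrable setT (EFin \o phi) ->
  fine (\int[mu]_x (phi x)%:E)%E <= P.
Proof.
move=> mix phi_int; set m := fine _.
rewrite leNgt; apply/negP => Pm.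
(* The Birkhoff deviation, K and c each cost at most e k, so one quarter of the excess survives. *)
set e := (m - P) / 4.
have e0 : 0 < e by rewrite divr_gt0// subr_gt0.
pose x : Sigma := point.
(* Fixing the first letter makes c(z_0) a constant; atypical points fill at most half of this
   cylinder. *)
set C0 := cyl 0 (coords x) : set Sigma.
have C00 : 0 < fine (mu C0) / 2 by rewrite divr_gt0// (fine_cyl_gt0 gibbs).
near \oo => k.
have bad : (mu [set x | e <= `|k%:R^-1 * birkhoff phi k x - m|]%R <=
    (fine (mu C0) / 2)%:E)%E.
  by near: k; exact: (weak_law measurable_sshift inv mix phi_int e0 C00).
have k0 : (0 < k)%N by near: k; exact: nbhs_infty_gt.
have Kk : ln (K k) <= e * k%:R by near: k; exact: lnK_sublinear.
have ck : ln (c (coords x 0)) + 1 <= e * k%:R by near: k; exact: natr_ge_near.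
have [N [mN N0 gN]] := ae_gibbs_at gibbs.
have : ~ (C0 `<=` [set x | e <= `|k%:R^-1 * birkhoff phi k x - m|]%R `|` N).
  set E := [set x | e <= _]%R in bad *.
  have mE : measurable E.
    exact: (measurable_deviation k e m measurable_sshift phi_int).
  move=> CE; have : (mu C0 <= mu E + mu N)%E.
    apply: le_trans (measureU2 _ mE mN).
    apply: le_measure => //; apply: mem_set; first exact: measurable_cyl.
    exact: measurableU.
  rewrite N0 adde0 => /le_trans/(_ bad).
  rewrite -[leLHS]fineK ?cyl_fin_num// lee_fin; lra.
move=> /existsNP[z /not_implyP[Cz /not_orP[Ez Nz]]].
have gz : gibbs_at mu phi P K c z by apply: contrapT => ngz; apply: Nz; exact: gN.
have := gz k k0; rewrite (Cz 0%N (leqnn _)) ler_norml => /andP[h1 _].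
have h2 := lncyl_le0 mu k.-1 z.
have k0' : 0 < k%:R :> R by rewrite ltr0n.
have Sk : k%:R * (m - e) <= birkhoff phi k z.
  rewrite -ler_pdivlMl//; move: Ez => /= /negP; rewrite -ltNge ltr_norml => /andP[h _].
  lra.
have e4 : 4 * (e * k%:R) = (m - P) * k%:R by rewrite /e; field.
have ek : 0 < e * k%:R by rewrite mulr_gt0.
lra.
Unshelve. all: by end_near. Qed.

Lemma limn_esup_lt_near (f : nat -> \bar R) (s : R) : limn_esup f = s%:E ->
  forall e, 0 < e -> \forall k \near \oo, (f k < (s + e)%:E)%E.
Proof.
move=> fs e e0.
have : (limn_esup f < (s + e)%:E)%E by rewrite fs lte_fin ltrDl.
move=> /ereal_inf_lt[_ [V nV <-] Vs].
apply: filterS nV => k Vk; apply: le_lt_trans Vs.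
by apply: ereal_sup_ubound; exists k.
Qed.

Lemma limn_esup_ge0 (f : nat -> \bar R) : (forall k, 0 <= f k)%E -> (0 <= limn_esup f)%E.
Proof.
move=> f0; apply: le_ereal_inf_tmp => _ [V nV <-].
have [k Vk] := filter_ex nV.
by apply: le_trans (f0 k) _; apply: ereal_sup_ubound; exists k.
Qed.

Lemma lne_inv_cyl n x :
  (lne (mu (cyl n (coords x)))^-1 = (- lncyl mu n x)%:E)%E.
Proof.
rewrite (cyl_lncyl gibbs) inver gt_eqF ?expR_gt0// -expRN lne_EFin ?expR_gt0//.
by rewrite expRK.
Qed.

Variables (l : nat -> nat) (w : Sigma).

Lemma lnK_small_along :
  (~ has_ubound (range K) ->
    (limn_esup (fun n => ((l n)%:R / n%:R : R)%:E) < +oo)%E) ->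
  forall e : R, 0 < e -> \forall k \near \oo, ln (K (k + (l k).+1)) <= e * k%:R.
Proof.
move=> Kl e e0; have [[B KB]|/Kl lfin] := pselect (has_ubound (range K)).
  apply: filterS (natr_ge_near (ln B) e0) => k; apply: le_trans.
  have n0 : (0 < k + (l k).+1)%N by rewrite addnS.
  have [K1 _] := gibbs_K gibbs n0.
  have K0 : 0 < K (k + (l k).+1) by exact: lt_le_trans ltr01 K1.
  have KB' : K (k + (l k).+1) <= B by apply: KB; exists (k + (l k).+1)%N.
  by rewrite ler_ln ?posrE//; exact: lt_le_trans KB'.
have l0 : (0 <= limn_esup (fun n => ((l n)%:R / n%:R : R)%:E))%E.
  by apply: limn_esup_ge0 => n; rewrite lee_fin divr_ge0.
have lE : limn_esup (fun n => ((l n)%:R / n%:R : R)%:E) =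
   (fine (limn_esup (fun n => ((l n)%:R / n%:R : R)%:E)))%:E.
  by rewrite fineK// ge0_fin_numE.
set L := fine _ in lE.
have L0 : 0 <= L by rewrite fine_ge0.
(* Eventually l k < (L + 1) k, hence k + l k + 1 <= (L + 3) k for k >= 1. *)
have eL : 0 < e / (L + 3) by rewrite divr_gt0// ltr_wpDl.
have [M _ MK] := lnK_sublinear eL.
apply: filterS3 (nbhs_infty_ge M) (nbhs_infty_gt 0) (limn_esup_lt_near lE ltr01) => k Mk k0.
rewrite lte_fin ltr_pdivrMr ?ltr0n// => lk.
apply: le_trans (MK (k + (l k).+1)%N _) _; first exact: leq_trans Mk (leq_addr _ _).
rewrite mulrAC ler_pdivrMr ?ltr_wpDl// -mulrA ler_pM2l//.
rewrite natrD -[((l k).+1)%:R]natr1.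
have k1 : 1 <= k%:R :> R by rewrite ler1n.
lra.
Qed.

Lemma target_large_along (s : R) :
  limn_esup (fun n => (n%:R^-1)%:E * lne (mu (cyl (l n) (coords w)))^-1)%E = s%:E ->
  forall e : R, 0 < e ->
  \forall k \near \oo, - (k%:R * (s + e)) <= lncyl mu (l k) w.
Proof.
move=> sE e e0; apply: filterS2 (nbhs_infty_gt 0) (limn_esup_lt_near sE e0) => k k0.
rewrite lne_inv_cyl -EFinM lte_fin mulrC ltr_pdivrMr ?ltr0n// => h; lra.
Qed.

(** A smaller eps admits fewer covers, so the limit at 0 from the right is a supremum, bounded below
    by its value at any one eps, here 1/2. *)
Lemma Mmeas_ge (a b : R) (E : set Sigma) :
  (forall e, (b%:E <= Mmeas_eps mu a E e)%E) -> (b%:E <= Mmeas mu a E)%E.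
Proof.
move=> H; have := @nonincreasing_at_right_cvge R (Mmeas_eps mu a E) 0 (BLeft 1) _ _.
rewrite bnd_simp ltr01 => /(_ isT) cv.
have {}cv := cvg_lim _ (cv _).
rewrite /Mmeas cv//; last first.
  move=> e e' _ _ ee'; apply: ereal_inf_le_tmp => _ [J [F [cF dF EF ->]]].
  exists J, F; split => // i Ji; apply: le_trans (dF i Ji) _.
  by rewrite lee_fin.
apply: le_trans (H (1/2)) _; apply: ereal_sup_ubound; exists (1/2) => //=.
by rewrite in_itv/=; apply/andP; split; lra.
Qed.

End Estimates.

(** * The lower bound for the dimension *)

Theorem corollary5p3 (R : realType) (I : countType) (A : transition I)
    (mu : probability (mshift R A) R) (phi : mshift R A -> R)
    (P : R) (K : nat -> R) (c : I -> R) (i : I)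
    (N : nat) (Phat : set (mshift R A)) (l : nat -> nat) (w : mshift R A) :
  let PG := gurevich_pressure phi i in
  let sbar := limn_esup (fun n =>
    (n%:R^-1)%:E * lne (mu (cyl (l n) (coords w)))^-1)%E in
  let h := fine PG - \int[mu]_x phi x in
  topologically_mixing R A ->
  local_weak_sigma_gibbs mu phi P K c ->
  atomless mu ->
  mixing_measure mu ->
  (\sum_(1 <= n <oo) Vsup phi n < +oo)%E ->
  (PG < +oo)%E ->
  mu.-integrable setT (EFin \o phi) ->
  is_cylinder N Phat ->
  (~ has_ubound (range K) ->
    (limn_esup (fun n => ((l n)%:R / n%:R : R)%:E) < +oo)%E /\
    (infinite_set [set: I] -> has_ubound (range phi))) ->
  hitting_point c w ->
  (sbar < +oo)%E ->
  ((h / (h + fine sbar))%:E <= Dim mu (Wset Phat l w))%E.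
Proof.
move=> PG sbar h tmix [gibbs inv] _ mix Vfin _ phi_int [Phat0 [u Phatu]] Kl _ sfin.
have i_ex : exists z : mshift R A, coords z 0 = i.
  by have [M /(_ M (leqnn M))[z [zi _]]] := tmix i i; exists z.
have PGE : PG = P%:E by exact: (gurevich_pressureE gibbs mix Vfin i_ex).
set m := fine (\int[mu]_x (phi x)%:E)%E.
have hE : h = P - m by rewrite /h PGE.
have h0 : 0 <= h by rewrite hE subr_ge0; exact: (entropy_ge0 gibbs inv).
have s0 : (0 <= sbar)%E.
  apply: limn_esup_ge0 => n; rewrite (lne_inv_cyl gibbs) -EFinM lee_fin.
  by rewrite mulr_ge0 ?invr_ge0// oppr_ge0 lncyl_le0.
have sE : sbar = (fine sbar)%:E by rewrite fineK// ge0_fin_numE.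
set s := fine sbar in sE *.
have s0' : 0 <= s by rewrite fine_ge0.
apply: le_ereal_inf_tmp => _ [a [a0 aW] <-]; rewrite lee_fin leNgt; apply/negP => ah.
(* If h + s = 0, the quotient is 0 by the convention for the inverse of 0, and no a >= 0 lies below
   it. *)
have hs0 : 0 < h + s.
  rewrite lt_neqAle addr_ge0// andbT; apply/eqP => hs.
  by move: ah; rewrite -hs invr0 mulr0 ltNge a0.
have ahs : a * s < (1 - a) * (P - m).
  by rewrite -hE; move: ah; rewrite ltr_pdivlMr// => ah; lra.
have a1 : a < 1.
  by apply: lt_le_trans ah _; rewrite ler_pdivrMr// mul1r lerDl.
have a01 : 0 <= a < 1 by rewrite a0 a1.
have [x Px] := Phat0.
have PhatE : Phat = cyl N (coords x).
  by move: Px; rewrite Phatu => /cylE.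
(* The value q mu(Phat)^a: a cover of content below b leaves Phat [uncovered], and [escape] then
   yields a point of [Wset Phat l w] that the cover misses. So M_a is at least b > 0. *)
set b := threshold mu w * expR (a * lncyl mu N x).
have b0 : 0 < b by rewrite mulr_gt0 ?expR_gt0//; exact: (threshold_gt0 gibbs).
have bE : b%:E = ((threshold mu w)%:E * poweR (mu (cyl N (coords x))) a)%E.
  by rewrite (poweR_cyl gibbs) EFinM.
suff : (b%:E <= Mmeas mu a (Wset Phat l w))%E by rewrite aW lee_fin leNgt b0.
apply: Mmeas_ge => e; apply: le_ereal_inf_tmp => _ [D [Cs [cylD _ cover ->]]].
rewrite leNgt; apply/negP => small.
have unc : uncovered mu w a D Cs N x.
  split=> [j Dj PhC|]; last first.
    rewrite -bE; apply: le_lt_trans small.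
    by apply: esum_le_subset => j [].
  (* A covering cylinder containing Phat would by itself have content at least mu(Phat)^a >= b. *)
  have [p cp] := cylD j Dj.
  move: small; rewrite ltNge => /negP; apply.
  apply: (@le_trans _ _ (poweR (mu (Cs j)) a)); last first.
    rewrite -(@esum_set1 R nat j (fun j => poweR (mu (Cs j)) a)) ?poweR_ge0//.
    by apply: esum_le_subset => _ ->.
  have CE := is_cylinderE cp (PhC _ (@cylxx _ _ _ N x)).
  rewrite CE (poweR_cyl gibbs) lee_fin -[leRHS]mul1r.
  apply: ler_pM; [exact/ltW/(threshold_gt0 gibbs)|exact: expR_ge0|exact: threshold_le1|].
  rewrite ler_expR ler_wpM2l//; apply: (le_lncyl gibbs).
  by rewrite -CE.
have Kl' := lnK_small_along gibbs (fun H => (Kl H).1).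
have [z [Pz Wz noz]] := escape gibbs inv mix phi_int Kl'
  (target_large_along gibbs sE) a01 ahs cylD unc.
have [j Dj Cz] := cover z (conj (eq_ind_r (fun S => S z) Pz PhatE) Wz).
exact: noz Dj Cz.
Qed.
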